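(* Let $N\ge1$ be an integer, $r>0$, $k\in(0,1)$, $u_n=n/N$ for $n=0,\dots,N$, and let $\rho:[0,1]\to(0,\infty)$ be non-decreasing and bounded with $\rho(u_0)<\rho(u_1)<\dots<\rho(u_N)$. Let $V_0,\dots,V_N$ be the value functions of the recursive optimal stopping problem in the context, with $V_{N+1}\equiv0$. Let $n\in\{0,\dots,N-1\}$ and suppose that there are points $b_{n+1}\le b_{n+2}\le\dots\le b_N$ in $(0,1)$ and constants $A_{n+1},\dots,A_N$ such that, for each $m=n+1,\dots,N$, $$V_m(\pi)=\begin{cases}A_mG_m(\pi),&\pi<b_m,\\ \pi-k+V_{m+1}(\pi),&\pi\ge b_m,\end{cases}\qquad \pi\in(0,1),$$ and $$(\gamma_m+k-1)b_m-\gamma_mk+(\gamma_m-\gamma_{m+1})V_{m+1}(b_m)=0$$ (for $m=N$ the last term on the left is $0$). Let $b_n$ be the unique point of $(0,c_n)$ with $f_n(b_n)=0$, where $$f_n(b)=(\gamma_n+k-1)b-\gamma_nk+(\gamma_n-\gamma_{n+1})V_{n+1}(b),$$ and define $$\hat V_n(\pi)=\begin{cases}A_nG_n(\pi),&\pi<b_n,\\ \pi-k+V_{n+1}(\pi),&\pi\ge b_n,\end{cases}$$ with $A_n$ determined by $A_nG_n(b_n)=b_n-k+V_{n+1}(b_n)$. Assume that $b_n\le b_{n+1}$. Then $\hat V_n=V_n$ on $(0,1)$.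
   Context: Notation: $\gamma(u)=\frac12+\sqrt{\frac14+\frac{2r}{\rho^2(u)}}>1$, $\gamma_n=\gamma(u_n)$, $G_n(\pi)=(1-\pi)\big(\frac{\pi}{1-\pi}\big)^{\gamma_n}$ for $\pi\in(0,1)$, and $c_n=\frac{\gamma_nk}{\gamma_n+k-1}$. For $u\in[0,1]$ and $\pi\in(0,1)$, under $\mathbb P^u_\pi$ (expectation $\mathbb E^u_\pi$) the process $\Pi^u$ is the belief process with constant signal-to-noise ratio $\rho(u)$: it solves $\mathrm d\Pi^u_t=\rho(u)\Pi^u_t(1-\Pi^u_t)\,\mathrm d\hat W_t$, $\Pi^u_0=\pi$, with $\hat W$ a standard Brownian motion (equivalently, $\Pi^u_t=\mathbb P^u_\pi(\theta=1\mid\mathcal F_t)$, where $\theta$ is Bernoulli with $\mathbb P^u_\pi(\theta=1)=\pi$, $\mathbb F=(\mathcal F_t)_{t\ge0}$ is the right-continuous filtration generated by $X_t=\theta\rho(u)t+W_t$, and $W$ is a Brownian motion independent of $\theta$). The value functions are defined recursively, with suprema over $\mathbb F$-stopping times $\tau\ge0$ (payoff $0$ on $\{\tau=\infty\}$), by $$V_N(\pi)=\sup_\tau\mathbb E^{u_N}_\pi\big[e^{-r\tau}(\Pi^{u_N}_\tau-k)\big],$$ $$V_n(\pi)=\sup_\tau\mathbb E^{u_n}_\pi\big[e^{-r\tau}\big(V_{n+1}(\Pi^{u_n}_\tau)+\Pi^{u_n}_\tau-k\big)\big],\quad n=0,\dots,N-1.$$ The function $f_n$ is convex with $f_n(0+)=-\gamma_nk<0$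 and $f_n(c_n)>0$, so it has exactly one zero in $(0,c_n)$. *)

(* Defs.v *)
From HB Require Import structures.
From mathcomp Require Import all_boot all_order all_algebra.
From mathcomp Require Import all_classical all_reals all_analysis.
Set Implicit Arguments.
Unset Strict Implicit.
Unset Printing Implicit Defensive.
Import Order.TTheory GRing.Theory Num.Theory.
Import numFieldNormedType.Exports.
Local Open Scope classical_set_scope.
Local Open Scope ring_scope.

(* Processes are indexed by all of R; only times t >= 0 are ever used. *)

(* The sigma-algebra generated by (Y s), s in D. *)
Definition sigma_process {R : realType} {T : Type} (Y : R -> T -> R)
    (D : set R) : set (set T) :=
  <<s \bigcup_(s in D) preimage_set_system setT (Y s) measurable >>.

Definition right_filtration {R : realType} {T : Type} (Y : R -> T -> R)
    (t : R) : set (set T) :=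
  \bigcap_(s in `]t, +oo[) sigma_process Y `[0, s].

Definition indep_systems {R : realType} {d} {T : measurableType d}
    (P : probability T R) (G H : set (set T)) : Prop :=
  forall A B, G A -> H B -> P (A `&` B) = (P A * P B)%E.

Record is_brownian {R : realType} {d} {T : measurableType d}
    (P : probability T R) (W : R -> T -> R) : Prop := {
  brownian_measurable : forall t, 0 <= t -> measurable_fun setT (W t) ;
  brownian_start : forall w, W 0 w = 0 ;
  brownian_continuous : forall w, {within `[0, +oo[, continuous (W ^~ w)} ;
  (* the second parameter of normal_prob is the standard deviation *)
  brownian_normal : forall s t, 0 <= s < t -> forall B, measurable B ->
    P [set w | B (W t w - W s w)] = normal_prob 0 (Num.sqrt (t - s)) B ;
  brownian_indep : forall s t, 0 <= s < t ->
    indep_systems P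
      (preimage_set_system setT (fun w => W t w - W s w) measurable)
      (sigma_process W `[0, s]) }.

(* The objects living under a measure P^u_pi; theta = 1 is coded by true. *)
Record belief_space (R : realType) := BeliefSpace {
  bs_display : measure_display ;
  bs_Omega : measurableType bs_display ;
  bs_prob : probability bs_Omega R ;
  bs_theta : bs_Omega -> bool ;
  bs_noise : R -> bs_Omega -> R ;
  bs_belief : R -> bs_Omega -> R ;
  bs_snr : R }.

Definition observation {R : realType} (S : belief_space R)
    (t : R) (w : bs_Omega S) : R :=
  (bs_theta w)%:R * bs_snr S * t + bs_noise t w.

Definition information {R : realType} (S : belief_space R) (t : R) :
    set (set (bs_Omega S)) :=
  right_filtration (@observation R S) t.

(* [belief_model rho p S]: the prior of theta = 1 is p, the signal-to-noise
   ratio is rho, and the belief process is the continuous (0,1)-valued version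
   of P(theta = 1 | F_t), where (F_t) is the right-continuous filtration
   generated by X_t = theta * rho * t + W_t.  The conditional probability is
   characterized by its defining property on the events of F_t. *)
Record belief_model {R : realType} (rho p : R) (S : belief_space R) : Prop := {
  belief_snr : bs_snr S = rho ;
  belief_theta_measurable : measurable_fun setT (@bs_theta R S) ;
  belief_prior : bs_prob S [set w | bs_theta w = true] = p%:E ;
  belief_brownian : is_brownian (bs_prob S) (@bs_noise R S) ;
  belief_indep : indep_systems (bs_prob S)
    (preimage_set_system setT (@bs_theta R S) measurable)
    (sigma_process (@bs_noise R S) `[0, +oo[) ;
  belief_adapted : forall t, 0 <= t -> forall B : set R, measurable B ->
    @information R S t (bs_belief (b := S) t @^-1` B) ;
  belief_posterior : forall t, 0 <= t ->
    forall A, @information R S t A ->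
    (\int[bs_prob S]_(w in A) (bs_belief t w)%:E)%E =
    bs_prob S (A `&` [set w | bs_theta w = true]) ;
  belief_continuous : forall w : bs_Omega S,
    {within `[0, +oo[, continuous (fun t => bs_belief t w)} ;
  belief_range : forall t (w : bs_Omega S), 0 <= t -> 0 < bs_belief t w < 1 }.

Definition is_stopping_time {R : realType} (S : belief_space R)
    (tau : bs_Omega S -> \bar R) : Prop :=
  (forall w, (0 <= tau w)%E) /\
  (forall t, 0 <= t -> @information R S t [set w | (tau w <= t%:E)%E]).

Definition payoff {R : realType} (r : R) (S : belief_space R)
    (g : R -> \bar R) (tau : bs_Omega S -> \bar R) (w : bs_Omega S) : \bar R :=
  if tau w is t%:E then ((expR (- (r * t)))%:E * g (bs_belief t w))%E else 0%E.

Definition optimal_value {R : realType} (r : R) (S : belief_space R)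
    (g : R -> \bar R) : \bar R :=
  ereal_sup [set (\int[bs_prob S]_w payoff r g tau w)%E
            | tau in @is_stopping_time R S].

Section recursive_problem.
Context {R : realType}.
Variables (r k : R) (N : nat) (S : R -> R -> belief_space R).

Definition grid (n : nat) : R := n%:R / N%:R.

(* [value_to_go j] is V_(N + 1 - j). *)
Fixpoint value_to_go (j : nat) : R -> \bar R :=
  if j is i.+1 then
    fun p => optimal_value r (S (grid (N - i)) p)
               (fun x => (value_to_go i x + (x - k)%:E)%E)
  else fun=> 0%E.

Definition value (n : nat) : R -> \bar R := value_to_go (N.+1 - n).

Lemma value_end : value N.+1 = fun=> 0%E.
Proof. by rewrite /value subnn. Qed.

Lemma value_rec (n : nat) (p : R) : (n <= N)%N ->
  value n p = optimal_value r (S (grid n) p)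
                (fun x => (value n.+1 x + (x - k)%:E)%E).
Proof. by move=> nN; rewrite /value subSS subSn//= subKn. Qed.

End recursive_problem.

Section explicit_functions.
Context {R : realType}.
Variables (r k : R) (N : nat) (rho : R -> R).

Definition gamma (u : R) : R :=
  2^-1 + Num.sqrt (4^-1 + 2 * r / rho u ^+ 2).

Definition gamma_ (n : nat) : R := gamma (grid N n).

Definition G_ (n : nat) (p : R) : R := (1 - p) * (p / (1 - p)) `^ gamma_ n.

Definition c_ (n : nat) : R := gamma_ n * k / (gamma_ n + k - 1).

(* For n = N this involves gamma_ N.+1, hence rho outside [0, 1], but only as
   a factor of V N.+1 = 0. *)
Definition f_ (V : nat -> R -> \bar R) (n : nat) (b : R) : \bar R :=
  (((gamma_ n + k - 1) * b - gamma_ n * k)%:E +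
   (gamma_ n - gamma_ n.+1)%:E * V n.+1 b)%E.

Definition threshold_fun (V : nat -> R -> \bar R) (n : nat) (A b p : R) :
    \bar R :=
  if p < b then (A * G_ n p)%:E else ((p - k)%:E + V n.+1 p)%E.

End explicit_functions.

(* Main.v *)
Require Import Defs.
From HB Require Import structures.
From mathcomp Require Import all_boot all_order all_algebra.
From mathcomp Require Import all_classical all_reals all_analysis.
From mathcomp Require Import measurable_realfun ring lra.
Set Implicit Arguments.
Unset Strict Implicit.
Unset Printing Implicit Defensive.
Import Order.TTheory GRing.Theory Num.Theory.
Import numFieldNormedType.Exports.
Local Open Scope classical_set_scope.
Local Open Scope ring_scope.

(** Write [y = ln (p / (1 - p))] for the log-odds and [v_m y = V_m p / (1 - p)].
    For [c = gamma_m] and [c = 1 - gamma_m] the process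
    [exp (- r t) (1 - Pi_t) (Pi_t / (1 - Pi_t)) ^ c] is a martingale.  Hence
    a majorant [alpha e^(gamma_m y) + beta e^((1 - gamma_m) y)], with
    [alpha, beta >= 0], of the payoff divided by [1 - p] bounds [v_m] from
    above, and the hitting time of [b_m] attains [A_m G_m] below [b_m].  Neither
    direction needs stochastic calculus: the martingales come from Bayes'
    formula for the belief and one Gaussian shift, and optional stopping is
    carried out on grids and passed to the limit with Fatou's lemma.

    The majorants are the tangents of [v_m] in the coordinates where it is
    concave.  Concavity follows from two facts propagated by downward induction
    on [m]: both [v_m e^(- gamma_m y)] and [(v_m' - v_m) e^(- gamma_m y)] are
    nonincreasing.  This is where [f_m(b_m) = 0] (smooth fit) and
    [b_m <= b_(m+1)] are used.  The induction reproves the threshold form of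
    [V_m] for all [m >= n], with the constants given by continuous fit. *)

(** Dividing by [1 - p] is a change of measure: integrals weighted by [1 - Pi t] become integrals
    over the event theta = 0, where the observation is pure noise, the log-odds are a Brownian
    motion with drift, and their exponentials have explicit means.

    The quantity v' - v is propagated because the stopping payoff reads (1 - k) e^y - k in these
    coordinates: d/dy - 1 annihilates the exponential and turns -k into k, so that adding the payoff
    to the next value adds only a positive constant to its gap.

    Two obstacles shape the probabilistic part. Stopping times refer to the right-continuous
    filtration, whereas Bayes' formula is proved for the raw information of X; the two are
    reconciled by right limits in time and by stopping only on grids. Moreover the belief is known
    to be the posterior only almost surely at each fixed time, so every pathwise argument must rest
    on the continuity of the belief itself. *)

(** * Derivatives of functions glued at a threshold *)

Section smooth_gluing.
Context {R : realType}.
Implicit Types (f g : R -> R) (x y b l : R).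

Lemma is_derive_cvgP f x l :
  is_derive x 1 f l <-> h^-1 * (f (h + x) - f x) @[h --> 0^'] --> l.
Proof.
have E : (fun h => h^-1 *: ((f \o shift x) (h *: (1 : R^o)) - f x))
    = (fun h => h^-1 * (f (h + x) - f x)).
  by apply/funext => h; rewrite /= /GRing.scale/= mulr1.
split=> [[fx <-]|fl].
  by rewrite /derive E; move: fx; rewrite /derivable E.
by split; rewrite /derivable /derive E; [apply/cvg_ex; exists l|exact/cvg_lim].
Qed.

Lemma is_derive_glue f g b l : f b = g b ->
  is_derive b 1 f l -> is_derive b 1 g l ->
  is_derive b 1 (fun y => if y < b then f y else g y) l.
Proof.
move=> fg /is_derive_cvgP fl /is_derive_cvgP gl; apply/is_derive_cvgP.
apply/cvgrPdist_lt => e e0; rewrite ltxx.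
move/cvgrPdist_lt : fl => /(_ _ e0) fl; move/cvgrPdist_lt : gl => /(_ _ e0) gl.
by near=> h; case: ifPn => _; [rewrite -fg|]; near: h.
Unshelve. all: by end_near. Qed.

Lemma is_derive_gluel f g b x l : x < b ->
  is_derive x 1 f l -> is_derive x 1 (fun y => if y < b then f y else g y) l.
Proof.
move=> xb fl; apply: near_eq_is_derive fl.
by near=> y; rewrite ifT//; near: y; exact: lt_nbhsl.
Unshelve. all: by end_near. Qed.

Lemma is_derive_gluer f g b x l : b < x ->
  is_derive x 1 g l -> is_derive x 1 (fun y => if y < b then f y else g y) l.
Proof.
move=> bx gl; apply: near_eq_is_derive gl.
near=> y; rewrite ifF//; apply/negbTE; rewrite -leNgt ltW//; near: y.
exact: lt_nbhsr.
Unshelve. all: by end_near. Qed.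

Lemma nondecreasing_is_derive f f' : (forall x, is_derive x 1 f (f' x)) ->
  (forall x, 0 <= f' x) -> forall x y, x <= y -> f x <= f y.
Proof.
move=> df f'0 x y; rewrite le_eqVlt => /predU1P[->//|xy].
have [|z _] := MVT xy (fun z _ => df z).
  by apply: derivable_within_continuous => z _; apply: ex_derive.
by move=> E; rewrite -subr_ge0 E mulr_ge0// subr_ge0 ltW.
Qed.

Lemma is_derive_max f f' x0 : (forall x, is_derive x 1 f (f' x)) ->
  (forall x, x <= x0 -> 0 <= f' x) -> (forall x, x0 <= x -> f' x <= 0) ->
  forall x, f x <= f x0.
Proof.
move=> df f'l f'r x.
have cf u v : {within `[u, v], continuous f}.
  by apply: derivable_within_continuous => z _; apply: ex_derive.
case: (ltgtP x x0) => [xx0|xx0|->//].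
  have [z zx E] := MVT xx0 (fun z _ => df z) (cf _ _).
  rewrite -subr_ge0 E mulr_ge0 ?subr_ge0 ?(ltW xx0)// f'l//.
  by rewrite ltW// (itvP zx).
have [z zx E] := MVT xx0 (fun z _ => df z) (cf _ _).
rewrite -subr_le0 E mulr_le0_ge0 ?subr_ge0 ?(ltW xx0)// f'r//.
by rewrite ltW// (itvP zx).
Qed.

End smooth_gluing.

(** * The shape of the value functions in log-odds *)

Section value_shape.
Context {R : realType}.
Implicit Types (y z gam b k a c : R) (v dv : R -> R).

(* Value functions are expressed in the log-odds [y = ln (p / (1 - p))] and
   divided by [1 - p]; [G_n] then becomes [expR (gamma_n * y)]. *)
Record value_shape gam b v dv : Prop := ValueShape {
  shape_derive : forall y, is_derive y 1 v (dv y) ;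
  shape_ge0 : forall y, 0 <= dv y ;
  shape_le : forall y, dv y <= gam * v y ;
  shape_gap : forall y, 0 <= dv y - v y ;
  shape_gap_decr : forall y z, y <= z ->
    (dv z - v z) * expR (- (gam * z)) <= (dv y - v y) * expR (- (gam * y)) ;
  shape_below : exists2 a, 0 <= a & forall y, y <= b ->
    v y = a * expR (gam * y) /\ dv y = gam * (a * expR (gam * y)) }.

Lemma is_derive_expRZ c a y :
  is_derive y 1 (fun z => a * expR (c * z)) (c * (a * expR (c * y))).
Proof.
apply: is_derive_eq; rewrite /GRing.scale/=; ring.
Qed.

Lemma value_shape0 gam b : value_shape gam b (fun=> 0) (fun=> 0).
Proof.
split=> *; rewrite ?(mulr0, subr0, mul0r)//.
  exact: is_derive_cst.
by exists 0 => // y _; rewrite mul0r mulr0.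
Qed.

Lemma shape_derive_mulexp gam b v dv c y : value_shape gam b v dv ->
  is_derive y 1 (fun z => v z * expR (c * z)) ((dv y + c * v y) * expR (c * y)).
Proof.
move=> vS; have dvy := shape_derive vS y.
apply: is_derive_eq; rewrite /GRing.scale/=; ring.
Qed.

Lemma shape_nondecreasing gam b v dv y z : value_shape gam b v dv ->
  y <= z -> v y <= v z.
Proof.
by move=> vS; apply: nondecreasing_is_derive (shape_derive vS) (shape_ge0 vS) _ _.
Qed.

Lemma shape_ratio_decr gam b v dv y z : value_shape gam b v dv ->
  y <= z -> v z * expR (- (gam * z)) <= v y * expR (- (gam * y)).
Proof.
move=> vS yz; rewrite -lerN2 -!mulNr.
pose w y := - (v y * expR (- gam * y)).
have dw (x : R) : is_derive x 1 w (- ((dv x + - gam * v x) * expR (- gam * x))).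
  by apply: is_deriveN; exact: shape_derive_mulexp vS.
have := nondecreasing_is_derive dw _ yz; rewrite /w -!mulNr; apply=> x.
rewrite -mulNr mulr_ge0 ?expR_ge0// oppr_ge0 mulNr subr_le0.
exact: shape_le vS _.
Qed.

(* [v] in terms of [expR ((2 gam - 1) y)], after division by
   [expR ((1 - gam) y)], is concave; the majorant below is its tangent. *)
Lemma shape_majorant gam b v dv y : 1 < gam -> value_shape gam b v dv ->
  exists a c, [/\ 0 <= a, 0 <= c,
    v y = a * expR (gam * y) + c * expR ((1 - gam) * y) &
    forall z, v z <= a * expR (gam * z) + c * expR ((1 - gam) * z)].
Proof.
move=> gam1 vS; have gam0 : 0 < 2 * gam - 1 by lra.
have gam_neq0 : 2 * gam - 1 != 0 by rewrite gt_eqF.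
have v0 x : 0 <= v x.
  by have := le_trans (shape_ge0 vS x) (shape_le vS x); rewrite pmulr_rge0//; lra.
(* Up to the factor [2 * gam - 1], the derivative of v e^((gam - 1) y) with respect to e^((2 gam -
   1) y). It is nonincreasing because dv + (gam - 1) v = (dv - v) + gam v splits it into the
   quantities of [shape_gap_decr] and [shape_ratio_decr]. *)
pose slope x := (dv x + (gam - 1) * v x) * expR (- (gam * x)).
have slope_decr x z : x <= z -> slope z <= slope x.
  move=> xz; have := lerD (shape_gap_decr vS xz)
    (ler_wpM2l (ltW (lt_trans ltr01 gam1)) (shape_ratio_decr vS xz)).
  rewrite /slope; set e1 := expR _; set e2 := expR _; lra.
(* Slope [a] and intercept [c] of the tangent at [y]; [shape_le] is exactly the sign of the
   intercept. *)
pose a := slope y / (2 * gam - 1).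
pose c := (gam * v y - dv y) * expR ((gam - 1) * y) / (2 * gam - 1).
have tangent : v y = a * expR (gam * y) + c * expR ((1 - gam) * y).
  have E1 : expR (- (gam * y)) * expR (gam * y) = 1.
    by rewrite -expRD addNr expR0.
  have E2 : expR ((gam - 1) * y) * expR ((1 - gam) * y) = 1.
    by rewrite -expRD -mulrDl -opprB addNr mul0r expR0.
  rewrite /a /c /slope.
  have -> : (dv y + (gam - 1) * v y) * expR (- (gam * y)) / (2 * gam - 1) *
      expR (gam * y) = (dv y + (gam - 1) * v y) / (2 * gam - 1).
    by rewrite -[RHS]mulr1 -[X in _ = _ * X]E1; field.
  have -> : (gam * v y - dv y) * expR ((gam - 1) * y) / (2 * gam - 1) *
      expR ((1 - gam) * y) = (gam * v y - dv y) / (2 * gam - 1).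
    by rewrite -[RHS]mulr1 -[X in _ = _ * X]E2; field.
  by field.
exists a, c; split => //.
- rewrite divr_ge0 ?(ltW gam0)// mulr_ge0 ?expR_ge0//.
  by rewrite addr_ge0 ?(shape_ge0 vS)// mulr_ge0//; lra.
- by rewrite divr_ge0 ?(ltW gam0)// mulr_ge0 ?expR_ge0// subr_ge0 (shape_le vS).
move=> z.
(* The concave function minus its linear part of slope [a] is largest at the point of tangency,
   where it equals the intercept. *)
pose h z := v z * expR ((gam - 1) * z) - a * expR ((2 * gam - 1) * z).
have dh (x : R) : is_derive x 1 h ((slope x - slope y) * expR ((2 * gam - 1) * x)).
  have dvx := shape_derive_mulexp (gam - 1) x vS.
  have dex := is_derive_expRZ (2 * gam - 1) a x.
  apply: is_derive_eq; rewrite /a /slope !mulrBl -!mulrA; congr (_ - _).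
    by rewrite -expRD; congr (_ * (expR _)); ring.
  by field.
have h_max : h z <= h y.
  apply: (is_derive_max dh) => x xy.
    by rewrite mulr_ge0 ?expR_ge0// subr_ge0 slope_decr.
  by rewrite mulr_le0_ge0 ?expR_ge0// subr_le0 slope_decr.
clearbody a; have hE x : v x - a * expR (gam * x) = h x * expR ((1 - gam) * x).
  rewrite /h mulrBl -!mulrA -!expRD.
  have -> : (gam - 1) * x + (1 - gam) * x = 0 by ring.
  by rewrite expR0 mulr1; congr (_ - _ * expR _); ring.
have hc : h y = c.
  have /eqP := hE y; rewrite {1}tangent (addrC (a * _)) addrK => /eqP.
  by move=> /mulIf E; apply/esym/E; rewrite gt_eqF ?expR_gt0.
by rewrite -lerBlDl hE -hc ler_pM2r ?expR_gt0.
Qed.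

(** With [g] the reward for stopping, [dg = gam * g - F] wherever the next value is a pure
    exponential of exponent [gam'], and [dg <= gam * g - F] everywhere. As [F] is nondecreasing and
    vanishes at [b], the ratio g e^(- gam y) rises up to [b] and falls afterwards, so the
    exponential fitted at [b] dominates [g] on its left. The equation for [b] is f_m(b_m) = 0
    divided by 1 - b_m. *)
Lemma shape_step k gam gam' b b' v' dv' : 0 < k < 1 -> 1 < gam ->
  gam' <= gam -> b <= b' -> value_shape gam' b' v' dv' ->
  (gam - 1) * ((1 - k) * expR b) - gam * k + (gam - gam') * v' b = 0 ->
  exists v dv a, 0 <= a /\ [/\ value_shape gam b v dv,
    forall y, (1 - k) * expR y - k + v' y <= v y,
    a * expR (gam * b) = (1 - k) * expR b - k + v' b,
    forall y, y < b -> v y = a * expR (gam * y) &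
    forall y, b <= y -> v y = (1 - k) * expR y - k + v' y].
Proof.
move=> /andP[k0 k1] gam1 gamle bb' vS Fb.
have gam0 : 0 < gam by lra.
pose g y := (1 - k) * expR y - k + v' y.
pose dg y := (1 - k) * expR y + dv' y.
pose F y := (gam - 1) * ((1 - k) * expR y) - gam * k + (gam - gam') * v' y.
have F_incr y z : y <= z -> F y <= F z.
  move=> yz; rewrite /F lerD ?lerD2r ?ler_wpM2l ?ler_expR ?(shape_nondecreasing vS)//;
    lra.
have dgF y : dv' y = gam' * v' y -> dg y = gam * g y - F y.
  by rewrite /dg /g /F => ->; ring.
have dgF_le y : dg y <= gam * g y - F y.
  by have := shape_le vS y; rewrite /dg /g /F; lra.
(* This is where [b <= b'] enters: up to [b] the next value is still in its own continuation region,
   so the identity for [dg] is exact there and yields smooth fit at [b]. *)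
have dvb y : y <= b -> dv' y = gam' * v' y.
  move=> yb; have [c _ cE] := shape_below vS.
  by have [-> ->] := cE _ (le_trans yb bb').
have fit : dg b = gam * g b by rewrite dgF ?dvb// /F Fb subr0.
have dg_ge0 y : 0 <= dg y.
  by rewrite addr_ge0 ?(shape_ge0 vS)// mulr_ge0 ?expR_ge0//; lra.
pose a := g b * expR (- (gam * b)).
have a0 : 0 <= a.
  by rewrite mulr_ge0 ?expR_ge0// -(pmulr_rge0 _ gam0) -fit.
have ab : a * expR (gam * b) = g b by rewrite -mulrA -expRD addNr expR0 mulr1.
have dg_derive y : is_derive y 1 g (dg y).
  have dv'y := shape_derive vS y.
  by apply: is_derive_eq; rewrite /GRing.scale/= /dg; ring.
have da_derive := is_derive_expRZ gam a.
pose v y := if y < b then a * expR (gam * y) else g y.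
pose dv y := if y < b then gam * (a * expR (gam * y)) else dg y.
have v_derive y : is_derive y 1 v (dv y).
  rewrite /dv; case: (ltgtP y b) => yb.
  - by apply: is_derive_gluel => //; exact: da_derive.
  - by apply: is_derive_gluer => //; exact: dg_derive.
  - rewrite yb; apply: is_derive_glue => //.
    by rewrite fit -ab; exact: da_derive.
have vl y : y <= b -> v y = a * expR (gam * y).
  by rewrite le_eqVlt => /predU1P[->|yb]; rewrite /v ?ltxx ?yb.
have dvl y : y <= b -> dv y = gam * (a * expR (gam * y)).
  by rewrite le_eqVlt => /predU1P[->|yb]; rewrite /dv ?ltxx ?yb ?fit ?ab.
have vr y : b <= y -> v y = g y by rewrite /v => /le_gtF ->.
have dvr y : b <= y -> dv y = dg y by rewrite /dv => /le_gtF ->.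
have gap_r y : b <= y -> dv y - v y = k + (dv' y - v' y).
  by move=> yb; rewrite vr// dvr// /g /dg; ring.
have gap_l y : y <= b -> dv y - v y = (gam - 1) * (a * expR (gam * y)).
  by move=> yb; rewrite vl// dvl//; ring.
have gap_decr_l y z : y <= z -> z <= b ->
    (dv z - v z) * expR (- (gam * z)) <= (dv y - v y) * expR (- (gam * y)).
  move=> yz zb; rewrite !gap_l ?(le_trans yz)// -!mulrA -!expRD.
  by rewrite !subrr.
have gap_decr_r y z : b <= y -> y <= z ->
    (dv z - v z) * expR (- (gam * z)) <= (dv y - v y) * expR (- (gam * y)).
  move=> yb yz; rewrite !gap_r ?(le_trans yb)// ![(k + _) * _]mulrDl lerD//.
    by rewrite ler_pM2l// ler_expR lerN2 ler_pM2l.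
  (* The old gap is monotone with the weight of exponent [gam']. Passing to [gam] multiplies it by a
     factor that is nonincreasing since [gam' <= gam], and the product is monotone because both
     factors are nonnegative. *)
  have E x : expR (- (gam * x)) = expR (- (gam' * x)) * expR ((gam' - gam) * x).
    by rewrite -expRD; congr expR; ring.
  rewrite !E !mulrA ler_pM ?expR_ge0 ?mulr_ge0 ?expR_ge0 ?(shape_gap vS)//.
    exact: shape_gap_decr vS _ _ yz.
  by rewrite ler_expR ler_wnM2l// subr_le0.
exists v, dv, a; split => //; split => //; last by move=> y /ltW; exact: vl.
  split => //.
  - move=> y; have [yb|/ltW by_] := leP y b; last by rewrite dvr.
    by rewrite dvl// mulr_ge0 ?(ltW gam0)// mulr_ge0 ?expR_ge0.
  - move=> y; have [yb|/ltW by_] := leP y b; first by rewrite dvl// vl.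
    rewrite dvr// vr//; apply: (le_trans (dgF_le y)).
    by rewrite gerBl -[leLHS]Fb; exact: F_incr.
  - move=> y; have [yb|/ltW by_] := leP y b.
      by rewrite gap_l// mulr_ge0 ?subr_ge0 ?(ltW gam1)// mulr_ge0 ?expR_ge0.
    by rewrite gap_r// addr_ge0 ?(shape_gap vS)// ltW.
  - move=> y z yz; have [zb|/ltW bz] := leP z b; first exact: gap_decr_l.
    have [yb|/ltW by_] := leP y b; last exact: gap_decr_r.
    exact: le_trans (gap_decr_r _ _ (lexx b) bz) (gap_decr_l _ _ yb (lexx b)).
  - by exists a => // y yb; rewrite vl ?dvl.
move=> y; have [yb|/ltW by_] := leP y b; last by rewrite vr.
have : g y * expR (- gam * y) <= g b * expR (- gam * b).
  have [z zb E] : exists2 z, z \in `[y, b]%R &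
      g b * expR (- gam * b) - g y * expR (- gam * y) =
      (dg z + - gam * g z) * expR (- gam * z) * (b - y).
    have dge (x : R) : is_derive x 1 (fun z => g z * expR (- gam * z))
        ((dg x + - gam * g x) * expR (- gam * x)).
      have dgx := dg_derive x.
      by apply: is_derive_eq; rewrite /GRing.scale/=; ring.
    apply: (MVT_segment yb (fun z _ => dge z)).
    by apply: derivable_within_continuous => z _; apply: ex_derive.
  rewrite -subr_ge0 E mulr_ge0 ?subr_ge0// mulr_ge0 ?expR_ge0//.
  have zb' : z <= b by rewrite (itvP zb).
  rewrite dgF ?dvb// mulNr addrAC subrr add0r oppr_ge0 -[leRHS]Fb.
  exact: F_incr.
by rewrite !mulNr -/a vl// [expR (- (gam * y))]expRN ler_pdivrMr ?expR_gt0.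
Qed.

End value_shape.

(** * Integration against a density *)

Section density.
Local Open Scope ereal_scope.
Context d (T : measurableType d) (R : realType).
Variables (mu nu : {measure set T -> \bar R}) (w : T -> R).
Hypotheses (mw : measurable_fun [set: T] w) (w0 : forall x, (0 <= w x)%R).
Hypothesis nuE : forall A, measurable A -> nu A = \int[mu]_(x in A) (w x)%:E.

Import HBNNSimple.

Let mw' : measurable_fun [set: T] (EFin \o w). Proof. exact/measurable_EFinP. Qed.
Let w0' x : 0 <= (w x)%:E. Proof. by rewrite lee_fin. Qed.

Let density_nnsfun (h : {nnsfun T >-> R}) :
  \int[nu]_x (h x)%:E = \int[mu]_x ((h x)%:E * (w x)%:E).
Proof.
have hE x : (h x)%:E = \sum_(y \in range h) (y * \1_(h @^-1` [set y]) x)%:E.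
  by rewrite fsumEFin// -fimfunE.
have h0 y x : 0 <= (y * \1_(h @^-1` [set y]) x)%:E.
  by rewrite EFinM nnfun_muleindic_ge0.
have mh y : measurable_fun setT (fun x => (y * \1_(h @^-1` [set y]) x)%:E).
  exact/measurable_EFinP/measurableT_comp.
under eq_integral do rewrite hE.
under [RHS]eq_integral do rewrite hE ge0_mule_fsuml//.
rewrite !ge0_integral_fsum//; first last.
- by move=> y x _; rewrite mule_ge0.
- by move=> y; exact: emeasurable_funM.
apply: eq_fsbigr => y; rewrite inE => -[x _ yE].
rewrite integralZl_indic_nnsfun// integral_indic// setIT nuE//.
under [RHS]eq_integral do rewrite EFinM -muleA.
rewrite [RHS]ge0_integralZl//.
- congr (_ * _); rewrite integral_mkcond; apply: eq_integral => z _.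
  by rewrite patchE indicE; case: ifPn; rewrite ?mul1e ?mul0e.
- by apply: emeasurable_funM => //; exact/measurable_EFinP.
- by move=> z _; rewrite mule_ge0// lee_fin.
- by rewrite lee_fin -yE.
Qed.

(** Monotone convergence from simple functions. The density is assumed on sets only, so that the
    lemma serves both the normal law and the restriction of a measure to an event, whose density is
    an indicator. *)
Lemma ge0_integral_density (f : T -> \bar R) : measurable_fun [set: T] f ->
  (forall x, 0 <= f x) -> \int[nu]_x f x = \int[mu]_x (f x * (w x)%:E).
Proof.
move=> mf f0; pose f_ := nnsfun_approx measurableT mf.
have f_lim x : (f_ n x)%:E @[n --> \oo] --> f x.
  by apply: cvg_nnsfun_approx.
have f_nd x : nondecreasing_seq (fun n => (f_ n x)%:E).
  by move=> m n mn; rewrite lee_fin; exact/lefP/nd_nnsfun_approx.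
have mf_ n : measurable_fun setT (EFin \o f_ n) by exact/measurable_EFinP.
have f_0 n x : 0 <= (f_ n x)%:E by rewrite lee_fin.
transitivity (limn (fun n => \int[nu]_x (f_ n x)%:E)).
  rewrite -monotone_convergence//.
  by apply: eq_integral => x _; exact/esym/cvg_lim.
under eq_fun do rewrite density_nnsfun.
rewrite -monotone_convergence//; first last.
- by move=> x _ m n mn; rewrite lee_wpmul2r// f_nd.
- by move=> n x _; rewrite mule_ge0.
- by move=> n; apply: emeasurable_funM => //; exact: mf_.
apply: eq_integral => x _; rewrite limeMr//; first by congr (_ * _); exact/cvg_lim.
by apply/cvg_ex; exists (f x).
Qed.

End density.

(** * Translation of Gaussian integrals *)

Section gaussian_shift.
Local Open Scope ereal_scope.
Context {R : realType}.
Local Notation mu := (@lebesgue_measure R).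

Lemma lebesgue_measure_shift (c : R) (A : set R) : measurable A ->
  pushforward mu (fun y : measurableTypeR R => (y + c)%R : measurableTypeR R) A
  = mu A.
Proof.
have mc : measurable_fun [set: measurableTypeR R]
    (fun y : measurableTypeR R => (y + c)%R : measurableTypeR R).
  exact: measurable_funD.
pose phi : {mfun measurableTypeR R >-> measurableTypeR R} :=
  HB.pack (fun y : measurableTypeR R => (y + c)%R : measurableTypeR R)
    (isMeasurableFun.Build _ _ _ _ _ mc).
move=> mA; apply/esym/(lebesgue_measure_unique (mu := pushforward mu phi)) => //=.
move=> _ [[a b]] _ <-.
rewrite /pushforward.
have -> : phi @^-1` `]a, b]%classic = `](a - c)%R, (b - c)%R]%classic.
  by apply/seteqP; split=> y /=; rewrite !in_itv/= ltrBlDr lerBrDr.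
rewrite !lebesgue_measure_itv/= !lte_fin ltrD2r.
by case: ifP => // _; rewrite -!EFinB; congr EFin; ring.
Qed.

Lemma ge0_integral_shift (c : R) (f : R -> \bar R) : measurable_fun [set: R] f ->
  (forall y, 0 <= f y) -> \int[mu]_y f (y + c)%R = \int[mu]_y f y.
Proof.
move=> mf f0.
have mc : measurable_fun [set: measurableTypeR R]
    (fun y : measurableTypeR R => (y + c)%R : measurableTypeR R).
  exact: measurable_funD.
rewrite -(@ge0_integral_pushforward _ _ _ _ _ _ mc _ setT f)//.
by apply: eq_measure_integral => A mA _; exact: lebesgue_measure_shift.
Qed.

Lemma ge0_integral_normal (m s : R) (f : R -> \bar R) :
  measurable_fun [set: R] f -> (forall y, 0 <= f y) ->
  \int[normal_prob m s]_y f y = \int[mu]_y (f y * (normal_pdf m s y)%:E).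
Proof.
move=> mf f0; apply: ge0_integral_density => //.
- exact: measurable_normal_pdf.
- by move=> y; exact: normal_pdf_ge0.
Qed.

(** Completing the square: the exponential times the centred density of variance [h] at y is that
    density at y - c h. Translation invariance of Lebesgue measure does the rest. *)
Lemma ge0_integral_normal_shift (c h : R) (f : R -> \bar R) : (0 < h)%R ->
  measurable_fun [set: R] f -> (forall y, 0 <= f y) ->
  \int[normal_prob 0 (Num.sqrt h)]_y
    ((expR (c * y - c ^+ 2 * h / 2))%:E * f y) =
  \int[normal_prob 0 (Num.sqrt h)]_y f (y + c * h)%R.
Proof.
move=> h0 mf f0.
have sh0 : Num.sqrt h != 0%R by rewrite gt_eqF// sqrtr_gt0.
have mpdf : measurable_fun setT (fun y => (normal_pdf 0 (Num.sqrt h) y)%:E).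
  by apply/measurable_EFinP; exact: measurable_normal_pdf.
have mexp : measurable_fun [set: R] (fun y => (expR (c * y - c ^+ 2 * h / 2))%:E).
  apply/measurable_EFinP; apply: measurableT_comp => //.
  by apply: measurable_funB => //; exact: measurable_funM.
rewrite !ge0_integral_normal//.
- rewrite -[RHS](ge0_integral_shift (- (c * h)%R)).
  + apply: eq_integral => y _; rewrite subrK muleAC muleC; congr (_ * _).
    rewrite -EFinM !normal_pdfE//; congr EFin.
    rewrite mulrCA; congr (_ * _)%R.
    rewrite /normal_fun -expRD sqr_sqrtr ?ltW//; congr expR.
    by field; rewrite gt_eqF.
  + apply: emeasurable_funM => //; apply: measurableT_comp => //.
    exact: measurable_funD.
  + by move=> y; rewrite mule_ge0// lee_fin normal_pdf_ge0.
- by apply: measurableT_comp => //; exact: measurable_funD.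
- exact: emeasurable_funM.
- by move=> y; rewrite mule_ge0// lee_fin expR_ge0.
Qed.

End gaussian_shift.

(** * Integration over independent variables *)

Section integral_indep.
Local Open Scope ereal_scope.
Context d (T : measurableType d) (R : realType).
Variable P : probability T R.

Lemma ge0_integral_mrestr (A : set T) (mA : measurable A) (f : T -> \bar R) :
  measurable_fun [set: T] f -> (forall x, 0 <= f x) ->
  \int[mrestr P mA]_x f x = \int[P]_(x in A) f x.
Proof.
move=> mf f0; rewrite (ge0_integral_density (mu := P) (w := \1_A))//.
- rewrite [RHS]integral_mkcond; apply: eq_integral => x _.
  by rewrite patchE indicE; case: ifPn; rewrite ?mule1 ?mule0.
- by move=> B mB; rewrite /= /mrestr integral_indic// setIC.
Qed.

(** The factorization says that under [P] restricted to [A] the joint law of [U] and [V] is a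
    product, so Tonelli's theorem applies. The variable of [V] stays outside: the inner integral,
    over [A] and in [U] alone, is the one an induction on time can treat. *)
Lemma ge0_integral_indep d1 d2 (T1 : measurableType d1)
    (T2 : measurableType d2) (A : set T) (U : T -> T1) (V : T -> T2)
    (nu : probability T2 R) (F : T1 * T2 -> \bar R) :
  measurable A -> measurable_fun [set: T] U -> measurable_fun [set: T] V ->
  (forall B C, measurable B -> measurable C ->
    P (A `&` U @^-1` B `&` V @^-1` C) = P (A `&` U @^-1` B) * nu C) ->
  measurable_fun [set: T1 * T2] F -> (forall z, 0 <= F z) ->
  \int[P]_(w in A) F (U w, V w) = \int[nu]_y \int[P]_(w in A) F (U w, y).
Proof.
move=> mA mU mV ind mF F0.
have mUV : measurable_fun [set: T] (fun w => (U w, V w)).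
  exact: measurable_fun_pair.
pose m1 : {measure set T1 -> \bar R} :=
  @measure_function_pushforward__canonical__measure_function_Measure
    _ _ _ _ _ (mrestr P mA) U mU.
have m1fin : fin_num_fun m1.
  move=> B mB; rewrite ge0_fin_numE//.
  apply: (@le_lt_trans _ _ (P setT)); last by rewrite probability_setT ltry.
  rewrite -[m1 B]/(P (U @^-1` B `&` A)) le_measure ?inE//; apply: measurableI => //.
  by rewrite -[X in measurable X]setTI; exact: (mU measurableT).
pose m1' : {finite_measure set T1 -> \bar R} :=
  HB.pack (Measure.sort m1) (Measure.class m1)
      (Measure_isFinite.Build _ _ _ m1 m1fin).
pose m12 : {measure set (T1 * T2) -> \bar R} :=
  @measure_function_pushforward__canonical__measure_function_Measure
    _ _ _ _ _ (mrestr P mA) (fun w => (U w, V w)) mUV.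
have m12E X : measurable X -> (m1' \x nu) X = m12 X.
  apply: product_measure_unique => B C mB mC.
  rewrite /= /pushforward /mrestr/= [U @^-1` B `&` A]setIC -ind//.
  by congr (P _); apply/seteqP; split=> w /=; rewrite /preimage/=; tauto.
transitivity (\int[m12]_z F z).
  rewrite ge0_integral_pushforward// preimage_setT ge0_integral_mrestr//.
    exact: measurableT_comp.
  by move=> w; exact: F0.
transitivity (\int[m1' \x nu]_z F z).
  by apply: eq_measure_integral => X mX _; exact/esym/m12E.
rewrite fubini_tonelli2//; apply: eq_integral => y _.
rewrite /fubini_G.
have mFy : measurable_fun [set: T1] (fun x => F (x, y)).
  exact: measurableT_comp.
rewrite ge0_integral_pushforward// preimage_setT ge0_integral_mrestr//.
  exact: measurableT_comp.
by move=> w; exact: F0.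
Qed.

End integral_indep.

(** * Sigma-algebras of processes and integrals over their events *)

Section process_sigma_algebra.
Context {R : realType} {d} {T : measurableType d} (Y : R -> T -> R).
Implicit Types (D : set R) (A B : set T) (F : (set T)^nat).

Lemma sigma_process_sigma_algebra D : sigma_algebra setT (sigma_process Y D).
Proof. exact: smallest_sigma_algebra. Qed.

Lemma sigma_process_gen D s (B : set R) : D s -> measurable B ->
  sigma_process Y D (Y s @^-1` B).
Proof.
move=> Ds mB; apply: sub_gen_smallest; exists s => //.
by exists B => //; rewrite setTI.
Qed.

Lemma sigma_process_min D (H : set (set T)) : sigma_algebra setT H ->
  (forall s (B : set R), D s -> measurable B -> H (Y s @^-1` B)) ->
  sigma_process Y D `<=` H.
Proof.
move=> sH DH; apply: smallest_sub => // _ [s Ds [B mB <-]].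
by rewrite setTI; exact: DH.
Qed.

Lemma sub_sigma_process D D' : D `<=` D' ->
  sigma_process Y D `<=` sigma_process Y D'.
Proof.
move=> DD'; apply: sigma_process_min; first exact: sigma_process_sigma_algebra.
by move=> s B /DD'; exact: sigma_process_gen.
Qed.

Lemma sigma_process_measurable D : (forall s, D s -> measurable_fun setT (Y s)) ->
  sigma_process Y D `<=` measurable.
Proof.
move=> mY; apply: sigma_process_min; first exact: sigma_algebra_measurable.
by move=> s B Ds mB; rewrite -[X in measurable X]setTI; exact: mY.
Qed.

Let gen D := \bigcup_(s in D) preimage_set_system setT (Y s) measurable.

Lemma sigma_process_measurable_fun D s : D s ->
  measurable_fun setT (Y s : g_sigma_algebraType (gen D) -> R).
Proof. by move=> Ds _ B mB; rewrite setTI; exact: sigma_process_gen. Qed.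

Lemma sigma_process_preimage D (f : T -> R) (B : set R) :
  measurable_fun setT (f : g_sigma_algebraType (gen D) -> R) -> measurable B ->
  sigma_process Y D (f @^-1` B).
Proof. by move=> mf mB; have := mf measurableT _ mB; rewrite setTI. Qed.

Lemma sigma_processC D A : sigma_process Y D A -> sigma_process Y D (~` A).
Proof. by rewrite -setTD; case: (sigma_process_sigma_algebra D) => _ + _; apply. Qed.

Lemma sigma_process_bigcup D F : (forall n, sigma_process Y D (F n)) ->
  sigma_process Y D (\bigcup_n F n).
Proof. by case: (sigma_process_sigma_algebra D) => _ _; apply. Qed.

Lemma sigma_process0 D : sigma_process Y D set0.
Proof. by case: (sigma_process_sigma_algebra D). Qed.

Lemma sigma_processT D : sigma_process Y D setT.
Proof. by rewrite -setC0; apply: sigma_processC; exact: sigma_process0. Qed.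

Lemma sigma_processI D A B : sigma_process Y D A -> sigma_process Y D B ->
  sigma_process Y D (A `&` B).
Proof.
move=> DA DB; rewrite -[A `&` B]setCK setCI -bigcup2E; apply: sigma_processC.
apply: sigma_process_bigcup => -[|[|n]]/=; last exact: sigma_process0.
- exact: sigma_processC.
- exact: sigma_processC.
Qed.

Lemma right_filtrationC t A : right_filtration Y t A -> right_filtration Y t (~` A).
Proof. by move=> tA s ts; apply: sigma_processC; exact: tA. Qed.

Lemma right_filtrationI t A B : right_filtration Y t A ->
  right_filtration Y t B -> right_filtration Y t (A `&` B).
Proof. by move=> tA tB s ts; apply: sigma_processI; [exact: tA|exact: tB]. Qed.

Lemma right_filtration_bigcup t F : (forall n, right_filtration Y t (F n)) ->
  right_filtration Y t (\bigcup_n F n).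
Proof. by move=> tF s ts; apply: sigma_process_bigcup => n; exact: tF. Qed.

Lemma right_filtration_bigcap t F : (forall n, right_filtration Y t (F n)) ->
  right_filtration Y t (\bigcap_n F n).
Proof.
move=> tF; rewrite -[\bigcap_n F n]setCK setC_bigcap; apply: right_filtrationC.
by apply: right_filtration_bigcup => n; exact: right_filtrationC.
Qed.

Lemma sub_right_filtration s t : s <= t ->
  right_filtration Y s `<=` right_filtration Y t.
Proof.
move=> st A sA u /=; rewrite in_itv/= andbT => tu.
by apply: sA; rewrite /= in_itv/= andbT (le_lt_trans st).
Qed.

Lemma right_filtration_sigma_process s t : s < t ->
  right_filtration Y s `<=` sigma_process Y `[0, t].
Proof. by move=> st A; apply; rewrite /= in_itv/= andbT. Qed.

End process_sigma_algebra.

Section integral_eq_gen.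
Local Open Scope ereal_scope.
Context d (T : measurableType d) (R : realType) (mu : {measure set T -> \bar R}).

(** Dynkin's argument on a pi-system containing the whole space; finiteness of the total integral
    permits the subtraction for complements. *)
Lemma integral_eq_gen (G : set (set T)) (f g : T -> \bar R) :
  setI_closed G -> G setT -> G `<=` measurable ->
  measurable_fun setT f -> measurable_fun setT g ->
  (forall x, 0 <= f x) -> (forall x, 0 <= g x) ->
  \int[mu]_x f x < +oo ->
  (forall E, G E -> \int[mu]_(x in E) f x = \int[mu]_(x in E) g x) ->
  forall E, <<s G >> E -> \int[mu]_(x in E) f x = \int[mu]_(x in E) g x.
Proof.
move=> GI GT Gm mf mg f0 g0 foo fg A sGA.
suff : <<s G >> `<=` [set A | measurable A /\
    \int[mu]_(x in A) f x = \int[mu]_(x in A) g x].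
  by move=> /(_ _ sGA)[].
apply: lambda_system_subset; [by []| |by move=> E GE; split; [exact: Gm|exact: fg]|by []].
have compl (h : T -> \bar R) (B : set T) : measurable_fun setT h ->
    (forall x, 0 <= h x) -> measurable B ->
    \int[mu]_x h x = \int[mu]_(x in B) h x + \int[mu]_(x in ~` B) h x.
  move=> mh h0 mB; rewrite -ge0_integral_setU ?setUv//.
  - exact: measurableC.
  - by apply/disj_setPS; rewrite setICr.
apply/dynkin_lambda_system; split.
- by split => //; exact: fg.
- move=> B [mB fgB]; split; first exact: measurableC.
  have := compl f B mf f0 mB; rewrite (fg _ GT) (compl g B mg g0 mB) fgB.
  have fin : \int[mu]_(x in B) g x \is a fin_num.
    rewrite -fgB ge0_fin_numE; last exact: integral_ge0.
    by apply: le_lt_trans foo; exact: ge0_subset_integral.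
  by move=> /(congr1 (fun z => z - \int[mu]_(x in B) g x));
    rewrite addeAC subee// add0e [in RHS]addeAC subee// add0e.
- move=> F tF FH; have mF n : measurable (F n) by have [] := FH n.
  split; first exact: bigcupT_measurable.
  rewrite !ge0_integral_bigcup//; first last.
  + exact: measurable_funTS.
  + exact: measurable_funTS.
  by apply: eq_eseriesr => n _; have [] := FH n.
Qed.

End integral_eq_gen.

Lemma measurable_integral_param d (T : measurableType d) (R : realType)
    (P : probability T R) d2 (T2 : measurableType d2) (A : set T)
    (F : T * T2 -> \bar R) : measurable A ->
  measurable_fun setT F -> (forall z, (0 <= F z)%E) ->
  measurable_fun setT (fun y => \int[P]_(w in A) F (w, y))%E.
Proof.
move=> mA mF F0.
rewrite (_ : (fun _ => _) = (fun y => \int[mrestr P mA]_w F (w, y))%E).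
  exact: (@measurable_fun_fubini_tonelli_G _ _ _ _ _ (mrestr P mA) F mF F0).
apply/funext => y; rewrite ge0_integral_mrestr//.
exact: measurableT_comp.
Qed.

(** * Log-odds and Bayes' formula for the observation *)

Definition logit {R : realType} (x : R) : R := ln x - ln (1 - x).

Lemma measurable_logit {R : realType} : measurable_fun setT (@logit R).
Proof.
apply: measurable_funB => //; apply: (measurableT_comp (@measurable_ln R)).
exact: measurable_funB.
Qed.

Lemma expR_logit {R : realType} (x : R) : 0 < x < 1 -> expR (logit x) = x / (1 - x).
Proof. by move=> /andP[x0 x1]; rewrite expRD expRN !lnK// posrE// subr_gt0. Qed.

(* Log-odds of [theta = 1] given [X_t = x]. *)
Definition logodds {R : realType} (rho p t x : R) : R :=
  logit p + rho * x - rho ^+ 2 * t / 2.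

Lemma measurable_logodds {R : realType} (rho p t : R) :
  measurable_fun setT (logodds rho p t).
Proof.
by apply: measurable_funB => //; apply: measurable_funD => //; exact: measurable_funM.
Qed.

Section belief_dynamics.
Context {R : realType} (S : belief_space R) (rho p : R).
Hypotheses (p01 : 0 < p < 1) (SB : belief_model rho p S).
Local Notation P := (bs_prob S).
Local Notation W := (@bs_noise R S).
Local Notation X := (@observation R S).
Local Notation is_theta b := [set w : bs_Omega S | bs_theta w = b].

Let BW := belief_brownian SB.

Lemma measurable_theta b : measurable (is_theta b).
Proof.
by rewrite -[X in measurable X]setTI;
  exact: (belief_theta_measurable SB measurableT (Y := [set b])).
Qed.

Lemma measurable_noise t : 0 <= t -> measurable_fun setT (W t).
Proof. exact: brownian_measurable BW t. Qed.

Lemma measurable_observation t : 0 <= t -> measurable_fun setT (X t).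
Proof.
move=> t0; apply: measurable_funD; last exact: measurable_noise.
apply: measurable_funM => //; apply: measurable_funM => //.
have mb : measurable_fun setT (fun b : bool => b%:R : R) by [].
exact: (measurableT_comp mb (belief_theta_measurable SB)).
Qed.

Lemma observationE t b w : bs_theta w = b -> X t w = b%:R * rho * t + W t w.
Proof. by move=> <-; rewrite /observation (belief_snr SB). Qed.

Lemma observation_incr s t b w : bs_theta w = b ->
  X t w = X s w + b%:R * rho * (t - s) + (W t w - W s w).
Proof. by move=> wb; rewrite !(observationE _ wb); ring. Qed.

Lemma observation0 w : X 0 w = 0.
Proof. by rewrite /observation (brownian_start BW) mulr0 addr0. Qed.

Lemma prob_theta b : P (is_theta b) = (if b then p else 1 - p)%:E.
Proof.
case: b; first exact: belief_prior SB.
have -> : is_theta false = ~` is_theta true.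
  by apply/seteqP; split=> w /=; case: bs_theta.
by rewrite probability_setC ?(belief_prior SB)//; exact: measurable_theta.
Qed.

Lemma info_measurable t : 0 <= t -> sigma_process X `[0, t] `<=` measurable.
Proof.
move=> t0; apply: sigma_process_measurable => s /=.
by rewrite in_itv/= => /andP[s0 _]; exact: measurable_observation.
Qed.

(** Once theta is fixed, the observation is the noise plus a deterministic drift, so generators
    correspond to generators; the events with such a trace form a sigma-algebra. *)
Lemma observation_noise t b A : sigma_process X `[0, t] A ->
  exists2 A', sigma_process W `[0, t] A' & A `&` is_theta b = A' `&` is_theta b.
Proof.
move: A; apply: sigma_process_min.
  split=> [|A [A' tA' AA']|F tF].
  - by exists set0 => //; exact: sigma_process0.
  - exists (~` A'); first exact: sigma_processC.
    rewrite setTD; apply/seteqP; split => w [nA wb]; split => // /[dup] wA _;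
      apply: nA.
      by have [] : (A `&` is_theta b) w by rewrite AA'.
    by have [] : (A' `&` is_theta b) w by rewrite -AA'.
  - have /choice[G GP] n : exists A', sigma_process W `[0, t] A' /\
        F n `&` is_theta b = A' `&` is_theta b.
      by have [A' ? ?] := tF n; exists A'.
    exists (\bigcup_n G n).
      by apply: sigma_process_bigcup => n; have [] := GP n.
    by rewrite !setI_bigcupl; apply: eq_bigcupr => n _; have [] := GP n.
move=> s B s0t mB; exists (W s @^-1` [set x | B (b%:R * rho * s + x)]).
  apply: sigma_process_gen => //.
  have : measurable_fun setT (fun x : R => b%:R * rho * s + x).
    exact: measurable_funD.
  by move=> /(_ measurableT _ mB); rewrite setTI.
by apply/seteqP; split => w [/= wB wb]; split => //=;
  [rewrite -(observationE _ wb)|rewrite (observationE _ wb)].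
Qed.

Lemma theta_indep b A : sigma_process W `[0, +oo[ A ->
  P (is_theta b `&` A) = (P (is_theta b) * P A)%E.
Proof.
by apply: belief_indep SB _ _ _; exists [set b] => //; rewrite setTI.
Qed.

(** After [A] is replaced by a noise event with the same trace, theta is separated from the whole
    noise, past and increment together, and only then the increment from the past. *)
Lemma increment_indep s t b A (C : set R) : 0 <= s -> s < t ->
  sigma_process X `[0, s] A -> measurable C ->
  P (A `&` is_theta b `&` [set w | C (W t w - W s w)]) =
  (P (A `&` is_theta b) * normal_prob 0 (Num.sqrt (t - s)) C)%E.
Proof.
move=> s0 st sA mC; have [A' sA' AA'] := observation_noise b sA.
have sub : sigma_process W `[0, s] `<=` sigma_process W `[0, +oo[.
  by apply: sub_sigma_process => u /=; rewrite !in_itv/= => /andP[->].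
have WC : sigma_process W `[0, +oo[ [set w | C (W t w - W s w)].
  apply: (@sigma_process_preimage _ _ _ W _ (fun w => W t w - W s w)) => //.
  by apply: measurable_funB; apply: sigma_process_measurable_fun => //=;
    rewrite in_itv/= andbT// (le_trans s0) ?ltW.
have PWC : P [set w | C (W t w - W s w)] = normal_prob 0 (Num.sqrt (t - s)) C.
  by apply: (brownian_normal BW); rewrite ?s0.
have A'C : P (A' `&` [set w | C (W t w - W s w)]) =
    (P A' * normal_prob 0 (Num.sqrt (t - s)) C)%E.
  rewrite setIC muleC -PWC; apply: (brownian_indep BW (s := s) (t := t)) => //.
    by rewrite s0.
  by exists C => //; rewrite setTI.
rewrite AA' (setIC A') -setIA !theta_indep//.
- by rewrite A'C muleA.
- exact: sub.
- by apply: sigma_processI => //; exact: sub.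
Qed.

Lemma info_gen t (B : set R) : 0 <= t -> measurable B ->
  sigma_process X `[0, t] (X t @^-1` B).
Proof. by move=> t0; apply: sigma_process_gen; rewrite /= in_itv/= t0 lexx. Qed.

Local Notation info t := (sigma_process X `[0, t]).

Local Open Scope ereal_scope.

Lemma integral_increment (s t : R) b A (F : R * R -> \bar R) :
  (0 <= s)%R -> (s < t)%R -> info s A ->
  measurable_fun setT F -> (forall z, 0 <= F z) ->
  \int[P]_(w in A `&` is_theta b) F (X s w, W t w - W s w)%R =
  \int[normal_prob 0 (Num.sqrt (t - s))]_y
    \int[P]_(w in A `&` is_theta b) F (X s w, y).
Proof.
move=> s0 st sA mF F0.
have t0 : (0 <= t)%R := le_trans s0 (ltW st).
apply: (ge0_integral_indep (T2 := measurableTypeR R)) => //.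
- by apply: measurableI; [exact: info_measurable sA|exact: measurable_theta].
- exact: measurable_observation.
- by apply: measurable_funB; exact: measurable_noise.
move=> B C mB mC.
have sAB : info s (A `&` X s @^-1` B).
  by apply: sigma_processI => //; exact: info_gen.
rewrite (setIAC A) /=.
exact: (increment_indep b s0 st sAB mC).
Qed.

(* A pi-system of events generating the information up to time [t], built so
   that properties propagate forward in time. *)
Inductive cylinder : R -> set (bs_Omega S) -> Prop :=
| cylinderT : cylinder 0%R setT
| cylinder_wait s t E : (s <= t)%R -> cylinder s E -> cylinder t E
| cylinder_observe t E B : measurable B -> cylinder t E ->
    cylinder t (E `&` X t @^-1` B).

Lemma cylinder_ge0 t E : cylinder t E -> (0 <= t)%R.
Proof. by elim=> // s t' E' st _ s0; exact: le_trans st. Qed.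

Lemma cylinder_setT t : (0 <= t)%R -> cylinder t setT.
Proof. by move=> t0; apply: cylinder_wait t0 _; exact: cylinderT. Qed.

(** The constructors observe only at the current time; an observation at an earlier time is moved
    back to its slot in the construction. Closure under intersection follows. *)
Lemma cylinder_insert s t E (B : set R) : (0 <= s)%R -> (s <= t)%R ->
  measurable B -> cylinder t E -> cylinder t (E `&` X s @^-1` B).
Proof.
move=> s0 st mB tE; elim: tE st => {t E} [s0'|u t E ut uE IH st|t E C mC tE IH st].
- have -> : s = 0%R by apply/eqP; rewrite eq_le s0 s0'.
  by apply: cylinder_observe => //; exact: cylinderT.
- have [su|/ltW us] := leP s u; first exact: cylinder_wait ut (IH su).
  apply: cylinder_wait st _; apply: cylinder_observe => //.
  exact: cylinder_wait us uE.
- by rewrite setIAC; apply: cylinder_observe => //; exact: IH.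
Qed.

Lemma cylinderI s t E E' : (s <= t)%R -> cylinder t E -> cylinder s E' ->
  cylinder t (E `&` E').
Proof.
move=> + tE sE'; elim: sE' => {s E'} [t0|s u E' su _ IH ut|s E' B mB sE' IH st].
- by rewrite setIT.
- exact: IH (le_trans su ut).
- rewrite setIA; apply: cylinder_insert => //; last exact: IH.
  exact: cylinder_ge0 sE'.
Qed.

Lemma cylinder_info t E : cylinder t E -> info t E.
Proof.
elim=> {t E} [|s t E st _|t E B mB tE IH]; first exact: sigma_processT.
  apply: sub_sigma_process => u /=; rewrite !in_itv/= => /andP[-> us].
  exact: le_trans us st.
by apply: sigma_processI => //; apply: info_gen => //; exact: cylinder_ge0 tE.
Qed.

Lemma cylinder_gen t : (0 <= t)%R -> info t `<=` <<s cylinder t >>.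
Proof.
move=> t0; apply: sigma_process_min; first exact: smallest_sigma_algebra.
move=> s B /=; rewrite in_itv/= => /andP[s0 st] mB.
apply: sub_gen_smallest; rewrite -[_ @^-1` _]setTI.
by apply: cylinder_insert => //; exact: cylinder_setT.
Qed.

Let L t w := logodds rho p t (X t w).

(* Bayes' formula; the Gaussian shift used in the proof is a one-step Girsanov
   transformation. *)
Lemma cylinder_bayes t E : cylinder t E -> forall f : R -> \bar R,
  measurable_fun setT f -> (forall x, 0 <= f x) ->
  \int[P]_(w in E `&` is_theta true) f (X t w) =
  \int[P]_(w in E `&` is_theta false) (f (X t w) * (expR (L t w))%:E).
Proof.
elim=> {t E} [f mf f0|s t E st sE IH f mf f0|t E B mB tE IH f mf f0].
- rewrite !setTI.
  under eq_integral do rewrite observation0.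
  under [RHS]eq_integral do rewrite /L /logodds observation0.
  rewrite !integral_cst; try exact: measurable_theta.
  have /andP[p0 p1] := p01; have q0 : (0 < 1 - p)%R by rewrite subr_gt0.
  rewrite -muleA; congr (_ * _).
  suff : P (is_theta true) = (expR (logit p + rho * 0 -
      rho ^+ 2 * 0 / 2))%:E * P (is_theta false) by [].
  rewrite !prob_theta -EFinM; congr EFin.
  by rewrite !mulr0 mul0r addr0 subr0 expR_logit// divfK// gt_eqF.
(* Waiting: freeze the noise increment between [s] and [t], apply the induction hypothesis to [f]
   shifted by it, and integrate over the increment last. *)
- move: st; rewrite le_eqVlt => /predU1P[<-|st]; first exact: IH.
  have s0 := cylinder_ge0 sE; have sIE := cylinder_info sE.
  pose h := (t - s)%R; have h0 : (0 < h)%R by rewrite subr_gt0.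
  pose N := normal_prob 0 (Num.sqrt h).
  have mE b : measurable (E `&` is_theta b).
    by apply: measurableI; [exact: info_measurable sIE|exact: measurable_theta].
  have mshift c : measurable_fun setT (fun z : R * R => f (z.1 + c + z.2)%R).
    apply: (measurableT_comp mf); apply: measurable_funD => //.
    exact: measurable_funD.
  have mshift1 c : measurable_fun setT (fun x : R => f (x + c)%R).
    by apply: (measurableT_comp mf); exact: measurable_funD.
  have mLs : measurable_fun setT (fun x => (expR (logodds rho p s x))%:E).
    apply/measurable_EFinP; apply: measurableT_comp => //.
    exact: measurable_logodds.
  have mexp : measurable_fun setT
      (fun y : R => (expR (rho * y - rho ^+ 2 * h / 2))%:E).
    apply/measurable_EFinP; apply: measurableT_comp => //.
    by apply: measurable_funB => //; exact: measurable_funM.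
  pose G z := f (z.1 + z.2)%R * (expR (logodds rho p s z.1))%:E.
  have mG : measurable_fun setT G.
    apply: emeasurable_funM.
      by apply: (measurableT_comp mf); exact: measurable_funD.
    exact: (measurableT_comp mLs).
  have G0 z : 0 <= G z by rewrite mule_ge0// lee_fin expR_ge0.
  pose H y := \int[P]_(w in E `&` is_theta false) G (X s w, y).
  have mH : measurable_fun setT H.
    apply: (@measurable_integral_param _ _ _ _ _ _ _ (fun z => G (X s z.1, z.2))) => //.
    apply: (measurableT_comp mG); apply: measurable_fun_pair => //.
    by apply: (measurableT_comp (measurable_observation s0)).
  have H0 y : 0 <= H y by exact: integral_ge0.
  transitivity (\int[N]_y H (y + rho * h)%R).
    transitivity (\int[P]_(w in E `&` is_theta true)
        (fun z => f (z.1 + rho * h + z.2)%R) (X s w, (W t w - W s w)%R)).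
      apply: eq_integral => w; rewrite inE => -[_ /= wt].
      by rewrite (observation_incr s t wt) mul1r.
    rewrite (integral_increment true s0 st sIE (mshift _))//.
    apply: eq_integral => y _ /=.
    under eq_integral do rewrite -addrA.
    rewrite (IH (fun x => f (x + (rho * h + y)))%R)//.
    by apply: eq_integral => w _; rewrite /G/= (addrC y).
  (* Between [s] and [t] the two values of theta differ by the drift rho h. The shift trades it for
     exp(rho y - rho^2 h / 2), which is the growth of e^L on theta = 0 for a noise increment y. *)
  rewrite -(ge0_integral_normal_shift rho h0 mH H0).
  transitivity (\int[P]_(w in E `&` is_theta false)
      (fun z => (expR (rho * z.2 - rho ^+ 2 * h / 2))%:E * G z)
      (X s w, (W t w - W s w)%R)).
    have mK : measurable_fun setT
        (fun z : R * R => (expR (rho * z.2 - rho ^+ 2 * h / 2))%:E * G z).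
      by apply: emeasurable_funM => //; exact: (measurableT_comp mexp).
    rewrite (integral_increment false s0 st sIE mK); last first.
      by move=> z; rewrite mule_ge0// lee_fin expR_ge0.
    apply: eq_integral => y _ /=; rewrite /H ge0_integralZl//.
    apply: measurable_funTS; apply: (measurableT_comp mG).
    by apply: measurable_fun_pair => //; exact: measurable_observation.
  apply: eq_integral => w; rewrite inE => -[_ /= wf].
  rewrite /G/= (observation_incr s t wf) !mul0r addr0 muleCA; congr (_ * _).
  rewrite -EFinM -expRD; congr (expR _)%:E.
  rewrite /L /logodds (observation_incr s t wf) /h !mul0r addr0.
  by ring.
(* Observing: the new event depends on [X t] only and is absorbed into [f], which is why [f] is
   quantified after the cylinder. *)
- rewrite (setIAC _ _ (is_theta true)) (setIAC _ _ (is_theta false)).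
  rewrite [LHS]integral_mkcondr [RHS]integral_mkcondr.
  have fB w : ((fun w => f (X t w)) \_ (X t @^-1` B)) w = (f \_ B) (X t w).
    by rewrite !patchE; congr (if _ then _ else _); apply/idP/idP; rewrite !inE.
  under eq_integral do rewrite fB.
  rewrite (IH (f \_ B)).
  + apply: eq_integral => w _; rewrite -fB !patchE.
    by case: ifP; rewrite ?mul0e.
  + by apply/(measurable_restrictT _ mB); exact: measurable_funTS.
  + by move=> x; apply: erestrict_ge0.
Qed.

End belief_dynamics.

(** * Exponential moments of the log-odds *)

Lemma continuous_inv1expR {R : realType} : continuous (fun x : R => (1 + expR x)^-1).
Proof.
move=> x; apply: cvgV; first by rewrite gt_eqF// addr_gt0// expR_gt0.
by apply: cvgD; [exact: cvg_cst|exact: continuous_expR].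
Qed.

Section belief_martingales.
Context {R : realType} (S : belief_space R) (rho p : R).
Hypotheses (p01 : 0 < p < 1) (SB : belief_model rho p S).
Local Notation P := (bs_prob S).
Local Notation X := (@observation R S).
Local Notation Pi := (@bs_belief R S).
Local Notation is_theta b := [set w : bs_Omega S | bs_theta w = b].
Local Notation info t := (sigma_process X `[0, t]).
Local Open Scope ereal_scope.

Let L t w := logodds rho p t (X t w).
(** Growth rate of the mean of e^(c L) on theta = 0, where L has volatility rho and drift - rho^2 /
    2. The exponents gamma and 1 - gamma are the ones at which it equals the discount rate. *)
Let rate c := (rho ^+ 2 * (c * (c - 1)) / 2)%R.
Let prior c := ((1 - p) * expR (c * logit p))%R.

Lemma measurable_L t : (0 <= t)%R -> measurable_fun setT (L t).
Proof.
move=> t0; apply: (measurableT_comp (measurable_logodds _ _ _)).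
exact: measurable_observation SB _ t0.
Qed.

Lemma measurable_expL c t : (0 <= t)%R ->
  measurable_fun setT (fun w => (expR (c * L t w))%:E).
Proof.
move=> t0; apply/measurable_EFinP; apply: measurableT_comp => //.
by apply: measurable_funM => //; exact: measurable_L.
Qed.

(** The integrand factors into [k], a function of the present that carries the growth, and [e] of
    the noise increment, whose mean is one by the Gaussian shift of the constant 1. *)
Lemma expL_step c s t A : (0 <= s)%R -> (s <= t)%R -> info s A ->
  \int[P]_(w in A `&` is_theta false) (expR (c * L t w))%:E =
  (expR (rate c * (t - s)))%:E *
    \int[P]_(w in A `&` is_theta false) (expR (c * L s w))%:E.
Proof.
move=> s0; rewrite le_eqVlt => /predU1P[<- _|st sA].
  by rewrite subrr mulr0 expR0 mul1e.
pose h := (t - s)%R; have h0 : (0 < h)%R by rewrite subr_gt0.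
have mA : measurable (A `&` is_theta false).
  apply: measurableI; first exact: info_measurable SB _ s0 _ sA.
  exact: measurable_theta SB _.
pose e y := (expR ((c * rho) * y - (c * rho) ^+ 2 * h / 2))%:E : \bar R.
have me : measurable_fun setT e.
  apply/measurable_EFinP; apply: measurableT_comp => //.
  by apply: measurable_funB => //; exact: measurable_funM.
pose k x := (expR (rate c * h + c * logodds rho p s x))%:E : \bar R.
have mk : measurable_fun setT k.
  apply/measurable_EFinP; apply: measurableT_comp => //.
  apply: measurable_funD => //; apply: measurable_funM => //.
  exact: measurable_logodds.
have mX : measurable_fun setT (fun w => k (X s w)).
  by apply: (measurableT_comp mk); exact: measurable_observation SB _ s0.
have mke : measurable_fun setT (fun z : R * R => k z.1 * e z.2).
  by apply: emeasurable_funM; [exact: (measurableT_comp mk)|exact: (measurableT_comp me)].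
transitivity (\int[P]_(w in A `&` is_theta false)
    (fun z => k z.1 * e z.2) (X s w, (bs_noise t w - bs_noise s w)%R)).
  apply: eq_integral => w; rewrite inE => -[_ /= wf].
  rewrite /k /e /L -EFinM -expRD /logodds (observation_incr SB s t wf).
  by congr (expR _)%:E; rewrite /rate /h mul0r !mul0r addr0; ring.
rewrite (integral_increment SB false s0 st sA mke); last first.
  by move=> z; rewrite mule_ge0// lee_fin expR_ge0.
transitivity (\int[normal_prob 0 (Num.sqrt h)]_y
    (e y * \int[P]_(w in A `&` is_theta false) k (X s w))).
  apply: eq_integral => y _ /=; rewrite muleC -ge0_integralZr//.
  - exact: measurable_funTS.
  - by move=> w _; rewrite lee_fin expR_ge0.
  - by rewrite lee_fin expR_ge0.
rewrite ge0_integralZr//; first last.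
- by apply: integral_ge0 => w _; rewrite lee_fin expR_ge0.
- by move=> y _; rewrite lee_fin expR_ge0.
have -> : \int[normal_prob 0 (Num.sqrt h)]_y e y = 1.
  transitivity (\int[normal_prob 0 (Num.sqrt h)]_y (e y * cst 1 y)).
    by apply: eq_integral => y _; rewrite mule1.
  rewrite (ge0_integral_normal_shift (c * rho) h0)//.
  by rewrite integral_cst// mul1e; exact: probability_setT.
rewrite mul1e -ge0_integralZl//.
- by apply: eq_integral => w _; rewrite /k expRD EFinM.
- by apply: measurable_funTS; exact: measurable_expL.
Qed.

Lemma expL_integral c t : (0 <= t)%R ->
  \int[P]_(w in is_theta false) (expR (c * L t w))%:E =
  (expR (rate c * t) * prior c)%:E.
Proof.
move=> t0; have := @expL_step c 0%R t setT (lexx _) t0 (@sigma_processT _ _ _ _ _).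
rewrite setTI subr0 => ->; rewrite EFinM; congr (_ * _).
under eq_integral do rewrite /L (observation0 SB).
rewrite /logodds !mulr0 mul0r addr0 subr0.
rewrite integral_cst; last exact: measurable_theta SB _.
rewrite muleC /prior EFinM; congr (_ * _).
exact: (prob_theta SB false).
Qed.

(* [(1 + expR (L t))^-1] is the posterior probability of [theta = 0]. *)
Lemma posterior_integral c t A : (0 <= t)%R -> info t A ->
  \int[P]_(w in A) ((1 + expR (L t w))^-1 * expR (c * L t w))%:E =
  \int[P]_(w in A `&` is_theta false) (expR (c * L t w))%:E.
Proof.
move=> t0 tA.
pose u l : R := ((1 + expR l)^-1 * expR (c * l))%R.
have u0 l : (0 <= u l)%R.
  by rewrite mulr_ge0 ?expR_ge0// invr_ge0 addr_ge0 ?expR_ge0.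
have mu : measurable_fun setT u.
  apply: measurable_funM.
    by apply: continuous_measurable_fun; exact: continuous_inv1expR.
  by apply: measurableT_comp => //; exact: measurable_funM.
pose v x := (u (logodds rho p t x))%:E : \bar R.
have mv : measurable_fun setT v.
  apply/measurable_EFinP; apply: (measurableT_comp mu).
  exact: measurable_logodds.
have v0 x : 0 <= v x by rewrite lee_fin.
have mX := measurable_observation SB t0.
have mvX : measurable_fun setT (fun w => v (X t w)) by exact: (measurableT_comp mv).
have mthf := measurable_theta SB false.
pose g := (fun w => (expR (c * L t w))%:E) \_ (is_theta false).
(* Split [E] by theta and carry the part theta = 1 over to theta = 0 by Bayes' formula: the weights
   add up to 1 + e^L, which cancels the posterior. *)
have cylE E : cylinder t E -> \int[P]_(w in E) v (X t w) = \int[P]_(w in E) g w.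
  move=> tE; have mE : measurable E.
    by apply: (info_measurable SB t0); exact: cylinder_info tE.
  have mEb b : measurable (E `&` is_theta b).
    by apply: measurableI => //; exact: measurable_theta SB _.
  transitivity (\int[P]_(w in (E `&` is_theta false) `|` (E `&` is_theta true)) v (X t w)).
    congr integral; apply/seteqP; split => w /=; last by case=> -[].
    by case: (bs_theta w) => ?; [right|left].
  rewrite ge0_integral_setU//; first last.
  - apply/disj_setPS => w [[_ /= ->] []]//.
  - exact: measurable_funTS.
  rewrite (cylinder_bayes p01 SB tE mv v0) -ge0_integralD//; first last.
  - apply: emeasurable_funM; first exact: measurable_funTS.
    apply: measurable_funTS; rewrite (_ : (fun _ => _) = (fun w => (expR (1 * L t w))%:E)).
      exact: measurable_expL.
    by apply/funext => w; rewrite mul1r.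
  - by move=> w _; rewrite mule_ge0// lee_fin expR_ge0.
  - exact: measurable_funTS.
  rewrite /g -integral_mkcondr; apply: eq_integral => w _.
  rewrite -EFinM -EFinD /u -/(L t w); congr EFin.
  by rewrite -[X in (X + _ = _)%R]mulr1 -mulrDr mulrAC mulVf ?mul1r.
have mg : measurable_fun setT g.
  by apply/(measurable_restrictT _ mthf); apply: measurable_funTS; exact: measurable_expL.
have g0 w : 0 <= g w by apply: erestrict_ge0 => ? _; rewrite lee_fin expR_ge0.
rewrite integral_mkcondr.
apply: (@integral_eq_gen _ _ _ _ (@cylinder R S t)) => //.
- by move=> E E' tE tE'; exact: cylinderI (lexx t) tE tE'.
- exact: cylinder_setT.
- by move=> E /cylinder_info; exact: (info_measurable SB t0).
- rewrite (cylE _ (cylinder_setT _ t0)) /g -integral_mkcond expL_integral//.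
  exact: ltry.
- exact: cylinder_gen.
Qed.

End belief_martingales.

(** * The belief is the posterior, and its martingales *)

Lemma within_continuous_seq {R : realType} (f : R -> R) (u : nat -> R) (t : R) :
  {within `[0, +oo[, continuous f} -> 0 <= t -> (forall n, 0 <= u n) ->
  u n @[n --> \oo] --> t -> f (u n) @[n --> \oo] --> f t.
Proof.
move=> /subspace_continuousP cf t0 u0 ut.
apply: (cvg_comp u f) => [|]; last by apply: cf; rewrite /= in_itv/= t0.
move=> B; rewrite /within/= => tB.
have : \forall n \near \oo, `[0, +oo[%classic (u n) -> B (u n) := ut _ tB.
by apply: filterS => n; apply; rewrite /= in_itv/= u0.
Qed.

Section belief_identification.
Context {R : realType} (S : belief_space R) (rho p : R).
Hypotheses (p01 : 0 < p < 1) (SB : belief_model rho p S).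
Local Notation P := (bs_prob S).
Local Notation X := (@observation R S).
Local Notation Pi := (@bs_belief R S).
Local Notation is_theta b := [set w : bs_Omega S | bs_theta w = b].
Local Notation info t := (sigma_process X `[0, t]).

Let L t w := logodds rho p t (X t w).

Lemma observation_continuous w : {within `[0, +oo[, continuous (X ^~ w)}.
Proof.
have /subspace_continuousP cW := @brownian_continuous _ _ _ _ _ (belief_brownian SB) w.
apply/subspace_continuousP => t t0; apply: cvgD; last exact: cW.
apply: cvg_within_filter; apply: cvgM; first exact: cvg_cst.
exact: cvg_id.
Qed.

Lemma measurable_belief t : 0 <= t -> measurable_fun setT (Pi t).
Proof.
move=> t0 _ B mB; rewrite setTI.
apply: (info_measurable SB (t := t + 1)); first by rewrite addr_ge0.
apply: right_filtration_sigma_process (belief_adapted SB t0 mB).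
by rewrite ltrDl.
Qed.

Lemma cvg_logodds (t : R) w (u : nat -> R) : 0 <= t -> (forall n, 0 <= u n) ->
  u n @[n --> \oo] --> t -> L (u n) w @[n --> \oo] --> L t w.
Proof.
move=> t0 u0 ut; apply: cvgB; last first.
  by apply: cvgM; [apply: cvgM => //; exact: cvg_cst|exact: cvg_cst].
apply: cvgD; first exact: cvg_cst.
apply: cvgM; first exact: cvg_cst.
exact: (within_continuous_seq (@observation_continuous w) t0 u0 ut).
Qed.

Let Y t w := (1 + expR (L t w))^-1.

Let measurable_Y t : 0 <= t -> measurable_fun setT (Y t).
Proof.
move=> t0; apply: (measurableT_comp (f := fun x : R => (1 + expR x)^-1)).
  by apply: continuous_measurable_fun; exact: continuous_inv1expR.
exact: measurable_L SB _ t0.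
Qed.

Let Y01 t w : 0 <= Y t w <= 1.
Proof.
have e0 := expR_gt0 (L t w).
have s0 : 0 < 1 + expR (L t w) by rewrite addr_gt0.
by rewrite /Y invr_ge0 (ltW s0) invf_le1// lerDl ltW.
Qed.

Local Open Scope ereal_scope.

(* Passing to the right limit is what brings in the right-continuous
   filtration. *)
Lemma posterior_right t A : (0 <= t)%R -> @information R S t A ->
  \int[P]_(w in A) (Y t w)%:E = P (A `&` is_theta false).
Proof.
move=> t0 tA; pose u n : R := (t + harmonic n)%R.
have tu n : (t < u n)%R by rewrite ltrDl harmonic_gt0.
have u0 n : (0 <= u n)%R by rewrite (le_trans t0)// ltW.
have ut : u n @[n --> \oo] --> t.
  by rewrite -[X in _ --> X]addr0; apply: cvgD; [exact: cvg_cst|exact: cvg_harmonic].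
have uA n : info (u n) A by exact: right_filtration_sigma_process tA.
have mA : measurable A by exact: (info_measurable SB (u0 0%N)).
have uE n : \int[P]_(w in A) (Y (u n) w)%:E = P (A `&` is_theta false).
  have := posterior_integral p01 SB 0 (u0 n) (uA n).
  under eq_integral do rewrite mul0r expR0 mulr1.
  under [RHS]eq_integral do rewrite mul0r expR0.
  move=> ->; rewrite integral_cst ?mul1e//.
  by apply: measurableI => //; exact: measurable_theta SB _.
have [] := @dominated_convergence _ _ _ P A mA (fun n w => (Y (u n) w)%:E)
  (fun w => (Y t w)%:E) (cst 1%E).
- by move=> n; apply/measurable_EFinP; apply: measurable_funTS; exact: measurable_Y.
- by apply/measurable_EFinP; apply: measurable_funTS; exact: measurable_Y.
- apply: aeW => w _; apply: cvg_EFin; first exact: nearW.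
  apply: (cvg_comp (L ^~ w \o u) (fun x : R => (1 + expR x)^-1)%R).
    exact: (@cvg_logodds t w u t0 u0 ut).
  exact: continuous_inv1expR.
- exact: finite_measure_integrable_cst.
- apply: aeW => w n _ /=; have /andP[Y0 Y1] := Y01 (u n) w.
  by rewrite lee_fin ger0_norm.
move=> _ _ /cvg_lim <- //; apply: lim_near_cst => //.
by apply: nearW => n /=; rewrite uE.
Qed.

Let integrable01 (f : bs_Omega S -> R) A : measurable A ->
  measurable_fun setT f -> (forall w, 0 <= f w <= 1)%R ->
  P.-integrable A (EFin \o f).
Proof.
move=> mA mf f01; apply: measurable_bounded_integrable => //.
- by apply: le_lt_trans (probability_le1 _ mA) _; rewrite ltry.
- exact: measurable_funTS.
- exists 1%R; split; first by rewrite realE ler01.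
  move=> x x1 w _ /=; have /andP[f0 f1] := f01 w.
  by rewrite ger0_norm// (le_trans f1)// ltW.
Qed.

Let cobelief01 t w : (0 <= t)%R -> (0 <= 1 - Pi t w <= 1)%R.
Proof.
move=> t0; have /andP[q0 q1] := belief_range SB w t0.
by rewrite subr_ge0 ltW//= lerBlDr lerDl ltW.
Qed.

Lemma cobelief_integral t A : (0 <= t)%R -> @information R S t A ->
  \int[P]_(w in A) (1 - Pi t w)%:E = P (A `&` is_theta false).
Proof.
move=> t0 tA.
have mA : measurable A.
  apply: (info_measurable SB (t := (t + 1)%R)); first by rewrite addr_ge0.
  by apply: right_filtration_sigma_process tA; rewrite ltrDl.
have mPi := measurable_belief t0.
have iPi : P.-integrable A (EFin \o Pi t).
  apply: integrable01 => // w; have /andP[? ?] := belief_range SB w t0.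
  by rewrite !ltW.
have PA : P A = P (A `&` is_theta true) + P (A `&` is_theta false).
  rewrite -measureU//; first last.
  - by apply/seteqP; split => w //= -[[_ ->] []].
  - by apply: measurableI => //; exact: measurable_theta SB _.
  - by apply: measurableI => //; exact: measurable_theta SB _.
  congr (P _); apply/seteqP; split => w /=; last by case=> -[].
  by case: (bs_theta w) => ?; [left|right].
under eq_integral do rewrite EFinB.
rewrite integralB_EFin//; last exact: finite_measure_integrable_cst.
transitivity (P A - P (A `&` is_theta true)).
  by congr (_ - _); [rewrite integral_cst// mul1e|exact: belief_posterior SB _ t0 _ tA].
rewrite PA addeAC subee ?add0e//.
apply: fin_num_measure; apply: measurableI => //; exact: measurable_theta SB _.
Qed.

(** Both sides are known at time [t] and have equal integrals over every event of [information];
    testing where their difference is nonnegative, and on the complement, forces it to vanish. The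
    null set depends on [t], so [L] serves for integrals at fixed times and [Pi] for everything
    stopped. *)
Lemma belief_ae t : (0 <= t)%R ->
  {ae P, forall w, (1 - Pi t w = (1 + expR (L t w))^-1)%R}.
Proof.
move=> t0; pose f w := ((1 - Pi t w) - Y t w)%R.
have mPi := measurable_belief t0.
have mf : measurable_fun setT f.
  by apply: measurable_funB; [exact: measurable_funB|exact: measurable_Y].
pose A := f @^-1` `[0%R, +oo[.
have tA : @information R S t A.
  move=> s /=; rewrite in_itv/= andbT => ts.
  apply: sigma_process_preimage; last exact: measurable_itv.
  apply: measurable_funB.
    apply: measurable_funB => // _ B mB; rewrite setTI.
    exact: right_filtration_sigma_process (belief_adapted SB t0 mB).
  apply: (measurableT_comp (f := fun x : R => ((1 + expR x)^-1)%R)).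
    by apply: continuous_measurable_fun; exact: continuous_inv1expR.
  apply: (measurableT_comp (measurable_logodds _ _ _)).
  by apply: sigma_process_measurable_fun; rewrite /= in_itv/= t0 ltW.
have int0 B : @information R S t B ->
    \int[P]_(w in B) (f w)%:E = 0 /\ \int[P]_(w in B) (- f w)%:E = 0.
  move=> tB; have mB : measurable B.
    apply: (info_measurable SB (t := (t + 1)%R)); first by rewrite addr_ge0.
    by apply: right_filtration_sigma_process tB; rewrite ltrDl.
  have iPi : P.-integrable B (EFin \o (fun w => 1 - Pi t w)%R).
    by apply: integrable01 => //; [exact: measurable_funB|move=> w; exact: cobelief01].
  have iY : P.-integrable B (EFin \o Y t).
    by apply: integrable01 => //; exact: measurable_Y.
  have fin : P (B `&` is_theta false) \is a fin_num.
    by apply: fin_num_measure; apply: measurableI => //; exact: measurable_theta SB _.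
  split.
    rewrite /f; under eq_integral do rewrite EFinB.
    by rewrite integralB_EFin// cobelief_integral// posterior_right// subee.
  under eq_integral do rewrite /f opprB EFinB.
  by rewrite integralB_EFin// cobelief_integral// posterior_right// subee.
have mA : measurable A by rewrite -[A]setTI; exact: mf.
have mfe : measurable_fun setT (fun w => (f w)%:E) by exact/measurable_EFinP.
have : \int[P]_w `|(f w)%:E| = 0.
  rewrite -(setUv A) ge0_integral_setU//; first last.
  - by apply/disj_setPS; rewrite setICr.
  - by apply: measurableT_comp => //; rewrite setUv.
  - exact: measurableC.
  rewrite (eq_integral (fun w => (f w)%:E)); last first.
    by move=> w; rewrite inE /A/= in_itv/= andbT => fw; rewrite ger0_norm.
  rewrite (int0 _ tA).1 add0e (eq_integral (fun w => (- f w)%:E)); last first.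
    move=> w; rewrite inE /A/= in_itv/= andbT => /negP; rewrite -ltNge => fw.
    by rewrite ltr0_norm.
  by rewrite (int0 _ _).2//; exact: right_filtrationC.
move=> /(ae_eq_integral_abs P measurableT mfe).
by apply: filterS => w /(_ I) [] /eqP; rewrite subr_eq0 => /eqP.
Qed.

Lemma belief_start : {ae P, forall w, Pi 0 w = p}.
Proof.
apply: filterS (belief_ae (lexx _)) => w.
rewrite /L (observation0 SB) /logodds !mulr0 mul0r addr0 subr0.
have /andP[p0 p1] := p01; have q0 : (0 < 1 - p)%R by rewrite subr_gt0.
rewrite expR_logit// => E.
have : (1 - Pi 0 w = 1 - p)%R by rewrite E; field; rewrite !gt_eqF//=; lra.
by move=> /(congr1 (fun z => 1 - z)%R); rewrite !subKr.
Qed.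

Definition exp_mart c t w : R :=
  expR (- (rho ^+ 2 * (c * (c - 1)) / 2 * t)) *
  ((1 - Pi t w) * expR (c * logit (Pi t w))).

Lemma exp_mart_ge0 c t w : (0 <= t)%R -> (0 <= exp_mart c t w)%R.
Proof.
move=> t0; rewrite mulr_ge0 ?expR_ge0// mulr_ge0 ?expR_ge0//.
by have /andP[] := cobelief01 w t0.
Qed.

Lemma measurable_exp_mart c t : (0 <= t)%R -> measurable_fun setT (exp_mart c t).
Proof.
move=> t0; have mPi := measurable_belief t0.
apply: measurable_funM => //; apply: measurable_funM; first exact: measurable_funB.
apply: measurableT_comp => //; apply: measurable_funM => //.
exact: (measurableT_comp measurable_logit).
Qed.

Let exp_martE c t A : (0 <= t)%R -> info t A ->
  \int[P]_(w in A) (exp_mart c t w)%:E =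
  (expR (- (rho ^+ 2 * (c * (c - 1)) / 2 * t)))%:E *
    \int[P]_(w in A `&` is_theta false) (expR (c * L t w))%:E.
Proof.
move=> t0 tA; have mA : measurable A by exact: (info_measurable SB t0).
rewrite -(posterior_integral p01 SB c t0 tA) -ge0_integralZl//; last first.
  apply/measurable_EFinP; apply: measurable_funTS; apply: measurable_funM.
    exact: measurable_Y.
  by apply/measurable_EFinP; exact: measurable_expL SB c _ t0.
apply: ae_eq_integral => //.
- by apply/measurable_EFinP; apply: measurable_funTS; exact: measurable_exp_mart.
- apply: emeasurable_funM => //.
  apply/measurable_EFinP; apply: measurable_funTS; apply: measurable_funM.
    exact: measurable_Y.
  by apply/measurable_EFinP; exact: measurable_expL SB c _ t0.
apply: filterS (belief_ae t0) => w PiE _ /=.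
rewrite -EFinM /exp_mart PiE; congr (_ * (_ * expR (c * _)))%:E.
have e0 := expR_gt0 (L t w).
have PiE' : Pi t w = (expR (L t w) / (1 + expR (L t w)))%R.
  by rewrite -[LHS](subKr 1%R) PiE; field; rewrite gt_eqF// addr_gt0.
apply: expR_inj; rewrite expR_logit ?(belief_range SB)// PiE PiE'.
by field; rewrite gt_eqF// addr_gt0.
Qed.

Lemma exp_mart_eq c s t A : (0 <= s)%R -> (s <= t)%R -> info s A ->
  \int[P]_(w in A) (exp_mart c t w)%:E = \int[P]_(w in A) (exp_mart c s w)%:E.
Proof.
move=> s0 st sA; have t0 := le_trans s0 st.
have tA : info t A.
  apply: sub_sigma_process sA => u /=; rewrite !in_itv/= => /andP[-> us].
  exact: le_trans us st.
rewrite !exp_martE// (expL_step SB c s0 st sA) muleA; congr (_ * _).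
by rewrite -EFinM -expRD; congr (expR _)%:E; ring.
Qed.

Lemma exp_mart_integral c t : (0 <= t)%R ->
  \int[P]_w (exp_mart c t w)%:E = ((1 - p) * expR (c * logit p))%:E.
Proof.
move=> t0; rewrite exp_martE//; last exact: sigma_processT.
rewrite setTI (expL_integral SB c t0) -EFinM mulrA -expRD.
by rewrite addNr expR0 mul1r.
Qed.

End belief_identification.

(** * Optional stopping on grids *)

Section le_integral.
Local Open Scope ereal_scope.
Context d (T : measurableType d) (R : realType) (mu : {measure set T -> \bar R}).

(* No measurability is assumed: the payoff of an arbitrary stopping rule is not
   known to be measurable. *)
Lemma le_integral_nonmeasurable (f g : T -> \bar R) :
  (forall x, 0 <= g x) -> (forall x, f x <= g x) ->
  \int[mu]_x f x <= \int[mu]_x g x.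
Proof.
move=> g0 fg; rewrite integralE; apply: (@le_trans _ _ (\int[mu]_x f^\+ x)).
  by rewrite geeDl// oppe_le0; apply: integral_ge0 => x _; exact: funeneg_ge0.
rewrite !ge0_integralTE//; apply: ereal_sup_le => _ [h hf <-].
exists h => // x; apply: (le_trans (hf x)).
by rewrite funeposE ge_max fg g0.
Qed.

End le_integral.

Section stopped_martingale.
Context {R : realType} (S : belief_space R) (rho p : R).
Hypotheses (p01 : 0 < p < 1) (SB : belief_model rho p S).
Local Notation P := (bs_prob S).
Local Notation X := (@observation R S).
Local Notation Pi := (@bs_belief R S).
Local Notation info t := (sigma_process X `[0, t]).
Local Notation mart := (@exp_mart R S rho).
Variable tau : bs_Omega S -> \bar R.
Hypothesis tauS : @is_stopping_time R S tau.

Let tau0 w : (0 <= tau w)%E. Proof. exact: tauS.1. Qed.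

(** The complement tau < t is the union of the events tau <= t - 1 / (n + 1), each decided strictly
    before [t] and hence in the raw information, on which the martingale identity holds. The test in
    [F] is there because a stopping time is constrained at nonnegative times only; at negative ones
    the event is empty. *)
Lemma stopping_ge_info t : 0 <= t -> info t [set w | (t%:E <= tau w)%E].
Proof.
move=> t0.
pose F n := if 0 <= t - harmonic n
  then [set w | (tau w <= (t - harmonic n)%:E)%E] else set0.
have -> : [set w | (t%:E <= tau w)%E] = ~` \bigcup_n F n.
  apply/seteqP; split => w /=.
    move=> tw [n _]; rewrite /F; case: ifP => //= _ wt.
    have := le_trans tw wt; rewrite lee_fin lerBrDr gerDl.
    by rewrite leNgt harmonic_gt0.
  apply: contra_notP => /negP; rewrite -ltNge => wt.
  have : tau w \is a fin_num by rewrite ge0_fin_numE// (lt_trans wt)// ltry.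
  move=> /fineK wE; move: wt; rewrite -wE lte_fin => /ltr_add_invr[n nt].
  have ft : fine (tau w) <= t - harmonic n by rewrite lerBrDr ltW.
  exists n => //; rewrite /F ifT ?(le_trans _ ft) ?fine_ge0//=.
  by rewrite -wE lee_fin.
apply: sigma_processC; apply: sigma_process_bigcup => n; rewrite /F.
case: ifPn => [tn|_]; last exact: sigma_process0.
apply: right_filtration_sigma_process (tauS.2 _ tn).
by rewrite gtrBl harmonic_gt0.
Qed.

(* [tau] rounded up to the grid of mesh [delta] and stopped at its [n]-th
   point. *)
Fixpoint grid_stop (delta : R) (n : nat) (w : bs_Omega S) : R :=
  if n is m.+1 then
    if ((m%:R * delta)%:E <= tau w)%E then m.+1%:R * delta
    else grid_stop delta m w
  else 0.

Lemma grid_stop_ge0 delta n w : 0 < delta -> 0 <= grid_stop delta n w.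
Proof.
by move=> d0; elim: n => //= n IH; case: ifP => _ //; rewrite mulr_ge0// ltW.
Qed.

Lemma grid_stopE delta n w : 0 < delta -> ((n%:R * delta)%:E <= tau w)%E ->
  grid_stop delta n w = n%:R * delta.
Proof.
move=> d0; case: n => [_|n nw] /=; first by rewrite mul0r.
rewrite ifT//; apply: le_trans nw; rewrite lee_fin ler_pM2r// ler_nat.
exact: leqnSn.
Qed.

Lemma grid_stop_near delta n w t : 0 < delta ->
  mine (tau w) (n%:R * delta)%:E = t%:E -> t <= grid_stop delta n w <= t + delta.
Proof.
move=> d0; elim: n t => [|n IH] t /=.
  by rewrite mul0r min_r ?tau0// => -[<-]; rewrite add0r lexx ltW.
have nS : n%:R * delta <= n.+1%:R * delta by rewrite ler_pM2r// ler_nat.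
case: ifPn => [nw|].
  move=> tE; have : (t%:E <= (n.+1%:R * delta)%:E)%E by rewrite -tE ge_min lexx orbT.
  have : ((n%:R * delta)%:E <= t%:E)%E by rewrite -tE le_min nw lee_fin.
  by rewrite !lee_fin -[n.+1%:R]natr1 mulrDl mul1r => ? ->; rewrite lerD2r.
rewrite -ltNge => wn; rewrite min_l; last first.
  by rewrite (le_trans (ltW wn))// lee_fin.
by move=> tE; apply: IH; rewrite min_l ?tE// -tE ltW.
Qed.

Let N c delta n w := mart c (grid_stop delta n w) w.

Let N_step c delta n w : N c delta n.+1 w =
  if ((n%:R * delta)%:E <= tau w)%E then mart c (n.+1%:R * delta) w
  else N c delta n w.
Proof. by rewrite /N/=; case: ifP. Qed.

Lemma grid_stop_mart_ge0 c delta n w : 0 < delta -> 0 <= N c delta n w.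
Proof. by move=> d0; apply: exp_mart_ge0 SB _ _ _ _; exact: grid_stop_ge0. Qed.

Let grid_info delta n : 0 < delta ->
  info (n%:R * delta) [set w | ((n%:R * delta)%:E <= tau w)%E].
Proof. by move=> d0; apply: stopping_ge_info; rewrite mulr_ge0// ltW. Qed.

Lemma measurable_grid_stop_mart c delta n : 0 < delta ->
  measurable_fun setT (N c delta n).
Proof.
move=> d0; elim: n => [|n IH].
  by apply: measurable_exp_mart SB _ _ _.
rewrite (_ : N c delta n.+1 = (fun w =>
   if ((n%:R * delta)%:E <= tau w)%E then mart c (n.+1%:R * delta) w
   else N c delta n w)); last by apply/funext => w; rewrite N_step.
apply: measurable_fun_ifT => //.
  apply: (@measurable_fun_bool _ _ _ _ true) => //; rewrite setTI.
  apply: (info_measurable SB (t := n%:R * delta)).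
    by rewrite mulr_ge0// ltW.
  exact: grid_info.
by apply: measurable_exp_mart SB _ _ _; rewrite mulr_ge0// ltW.
Qed.

Local Open Scope ereal_scope.

(** From [n] to [n.+1] the stop changes only where [n%:R * delta] has not passed [tau]. That event
    is known at the grid time [n%:R * delta], and on it the stop moves to the next grid time, so one
    martingale identity suffices. *)
Lemma grid_stop_mart_integral c delta n : (0 < delta)%R ->
  \int[P]_w (N c delta n w)%:E = ((1 - p) * expR (c * logit p))%:E.
Proof.
move=> d0; elim: n => [|n IH]; first by rewrite (exp_mart_integral p01 SB).
have nd0 m : (0 <= m%:R * delta)%R by rewrite mulr_ge0// ltW.
pose A := [set w | (n%:R * delta)%:E <= tau w].
have Ainfo : info (n%:R * delta)%R A by exact: grid_info.
have mA : measurable A by exact: info_measurable SB _ (nd0 n) _ Ainfo.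
have split_int (f : bs_Omega S -> R) : measurable_fun setT f -> (forall w, 0 <= f w)%R ->
    \int[P]_w (f w)%:E = \int[P]_(w in A) (f w)%:E + \int[P]_(w in ~` A) (f w)%:E.
  move=> mf f0; rewrite -ge0_integral_setU ?setUv//.
  - exact: measurableC.
  - exact/measurable_EFinP.
  - by move=> w _; rewrite lee_fin.
  - by apply/disj_setPS; rewrite setICr.
rewrite -IH !split_int//; try by [exact: measurable_grid_stop_mart|
  move=> w; exact: grid_stop_mart_ge0].
congr (_ + _).
  transitivity (\int[P]_(w in A) (mart c (n.+1%:R * delta)%R w)%:E).
    by apply: eq_integral => w; rewrite inE N_step /A/= => ->.
  rewrite (exp_mart_eq p01 SB c (nd0 n) _ Ainfo).
    apply: eq_integral => w; rewrite inE /A/= => nw.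
    by rewrite /N grid_stopE.
  by rewrite ler_pM2r// ler_nat.
by apply: eq_integral => w; rewrite inE /A/= N_step => /negP/negbTE ->.
Qed.

End stopped_martingale.

(** * From grids to arbitrary stopping times *)

Lemma logit_cvg {R : realType} (u : nat -> R) (x : R) : 0 < x < 1 ->
  u n @[n --> \oo] --> x -> logit (u n) @[n --> \oo] --> logit x.
Proof.
move=> /andP[x0 x1] ux.
have x1' : 0 < 1 - x by rewrite subr_gt0.
have ux' : 1 - u n @[n --> \oo] --> 1 - x by apply: cvgB => //; exact: cvg_cst.
apply: cvgB; first exact: continuous_cvg (continuous_ln x0) ux.
exact: continuous_cvg (continuous_ln x1') ux'.
Qed.

Section stopped_limits.
Context {R : realType} (S : belief_space R) (rho p : R).
Hypotheses (p01 : 0 < p < 1) (SB : belief_model rho p S).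
Local Notation P := (bs_prob S).
Local Notation Pi := (@bs_belief R S).
Local Notation mart := (@exp_mart R S rho).

Lemma exp_mart_cvg c w (u : nat -> R) (t : R) : 0 <= t -> (forall n, 0 <= u n) ->
  u n @[n --> \oo] --> t -> mart c (u n) w @[n --> \oo] --> mart c t w.
Proof.
move=> t0 u0 ut.
have Pit : Pi (u n) w @[n --> \oo] --> Pi t w.
  exact: (within_continuous_seq (@belief_continuous _ _ _ _ SB w) t0 u0 ut).
set lam := (rho ^+ 2 * (c * (c - 1)) / 2)%R.
have ut' : - (lam * u n) @[n --> \oo] --> - (lam * t).
  by apply: cvgN; apply: cvgM => //; exact: cvg_cst.
have lt' : c * logit (Pi (u n) w) @[n --> \oo] --> c * logit (Pi t w).
  apply: cvgM; first exact: cvg_cst.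
  by apply: logit_cvg => //; exact: belief_range SB _ _ t0.
apply: cvgM; first exact: (cvg_comp _ _ ut' (@continuous_expR R _)).
apply: cvgM; last exact: (cvg_comp _ _ lt' (@continuous_expR R _)).
by apply: cvgB => //; exact: cvg_cst.
Qed.

Variable tau : bs_Omega S -> \bar R.
Hypothesis tauS : @is_stopping_time R S tau.

Let tau0 w : (0 <= tau w)%E. Proof. exact: tauS.1. Qed.

Lemma grid_stop_le delta n w : 0 < delta -> grid_stop tau delta n w <= n%:R * delta.
Proof.
move=> d0; elim: n => [|n IH] /=; first by rewrite mul0r.
case: ifP => // _; apply: (le_trans IH).
by rewrite ler_pM2r// ler_nat.
Qed.

Lemma grid_stop_cvg (delta : nat -> R) (m : nat -> nat) w t :
  (forall n, 0 < delta n) -> delta n @[n --> \oo] --> 0 ->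
  (\forall n \near \oo, mine (tau w) ((m n)%:R * delta n)%:E = t%:E) ->
  grid_stop tau (delta n) (m n) w @[n --> \oo] --> t.
Proof.
move=> d0 dcvg mE.
apply: (@squeeze_cvgr _ _ _ _ (fun=> t) (fun n => t + delta n)).
- by near=> n; apply: (grid_stop_near tauS) => //; near: n.
- exact: cvg_cst.
- by rewrite -[X in _ --> X]addr0; apply: cvgD => //; exact: cvg_cst.
Unshelve. all: by end_near. Qed.

Local Open Scope ereal_scope.

Let init c := ((1 - p) * expR (c * logit p))%R.

Let integrable_ge0 (f : bs_Omega S -> R) : measurable_fun setT f ->
  (forall w, 0 <= f w)%R -> \int[P]_w (f w)%:E < +oo -> P.-integrable setT (EFin \o f).
Proof.
move=> mf f0 foo; apply/integrableP; split; first exact/measurable_EFinP.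
by under eq_integral do rewrite /= ger0_norm//.
Qed.

(** Fatou's lemma along finer grids. Mass may be lost where [tau] is infinite, but there the
    integrand is 0 and the bound goes the right way. *)
Lemma stopped_upper (a b c d : R) : (0 <= a)%R -> (0 <= b)%R ->
  \int[P]_w (if tau w is t%:E then (a * mart c t w + b * mart d t w)%:E else 0)
  <= (a * init c + b * init d)%:E.
Proof.
(* A square number of steps makes the horizon n + 1 grow while the mesh 1 / (n + 1) shrinks. *)
move=> a0 b0; pose delta := @harmonic R; pose m n := (n.+1 * n.+1)%N.
have d0 n : (0 < delta n)%R by exact: harmonic_gt0.
have mdE n : ((m n)%:R * delta n)%R = n.+1%:R.
  by rewrite /m /delta natrM mulfK.
pose N c n w := mart c (grid_stop tau (delta n) (m n) w) w.
pose f n w := (a * N c n w + b * N d n w)%R.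
have N0 e n w : (0 <= N e n w)%R by exact: (grid_stop_mart_ge0 SB).
have mN e n : measurable_fun setT (N e n).
  exact: (measurable_grid_stop_mart SB tauS).
have NE e n : \int[P]_w (N e n w)%:E = (init e)%:E.
  exact: (grid_stop_mart_integral p01 SB tauS).
have f0 n w : (0 <= f n w)%R by rewrite addr_ge0// mulr_ge0.
have mf n : measurable_fun setT (fun w => (f n w)%:E).
  by apply/measurable_EFinP; apply: measurable_funD; exact: measurable_funM.
have fE n : \int[P]_w (f n w)%:E = (a * init c + b * init d)%:E.
  have mNe e : measurable_fun setT (fun w => (N e n w)%:E) by exact/measurable_EFinP.
  have N0e e w : 0 <= (N e n w)%:E by rewrite lee_fin.
  transitivity (\int[P]_w (a%:E * (N c n w)%:E + b%:E * (N d n w)%:E)); first by [].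
  rewrite ge0_integralD//.
  - by rewrite !ge0_integralZl// !NE.
  - by move=> w _; rewrite mule_ge0.
  - exact: emeasurable_funM.
  - by move=> w _; rewrite mule_ge0.
  - exact: emeasurable_funM.
have := fatou P measurableT mf (fun n w _ => f0 n w).
under [X in _ <= limn_einf X]eq_fun do rewrite fE.
rewrite (cvg_limn_einf_sup (cvg_cst _)).1; apply: le_trans.
apply: le_integral_nonmeasurable => w.
  rewrite limn_einf_lim; apply: lime_ge; first exact: is_cvg_einfs.
  by apply: nearW => n; apply: le_ereal_inf_tmp => _ [i _ <-]; rewrite lee_fin.
have ge0 : 0 <= limn_einf (fun n => (f n w)%:E).
  rewrite limn_einf_lim; apply: lime_ge; first exact: is_cvg_einfs.
  by apply: nearW => n; apply: le_ereal_inf_tmp => _ [i _ <-]; rewrite lee_fin.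
case tw : (tau w) => [t| |] //.
have t0 : (0 <= t)%R by rewrite -lee_fin -tw.
have cvgt : grid_stop tau (delta n) (m n) w @[n --> \oo] --> t.
  apply: grid_stop_cvg => //; first exact: cvg_harmonic.
  near=> n; rewrite tw min_l// lee_fin mdE.
  by rewrite (le_trans _ (_ : n%:R <= _)%R) ?ler_nat//; near: n; exact: nbhs_infty_ger.
suff : (f n w)%:E @[n --> \oo] --> (a * mart c t w + b * mart d t w)%:E.
  by move=> /cvg_limn_einf_sup[->].
apply: cvg_EFin; first exact: nearW.
apply: cvgD; apply: cvgM; try exact: cvg_cst.
  by apply: exp_mart_cvg => // n; exact: grid_stop_ge0.
by apply: exp_mart_cvg => // n; exact: grid_stop_ge0.
Unshelve. all: by end_near. Qed.

(* Uniform integrability up to a finite horizon is obtained by domination with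
   the martingale of exponent [2 * c]. *)
Lemma exp_mart_le c t T w (e : R) : (0 <= t <= T)%R -> (0 < e)%R ->
  (mart c t w <= e * expR (rho ^+ 2 * c ^+ 2 * T) * mart (2 * c) t w
                 + (4 * e)^-1)%R.
Proof.
move=> /andP[t0 tT] e0; have /andP[q0 q1] := belief_range SB w t0.
pose lam : R := (rho ^+ 2 * (c * (c - 1)) / 2)%R.
pose x := expR (- (lam * t) + c * logit (Pi t w)).
have xE : mart c t w = ((1 - Pi t w) * x)%R.
  by rewrite /exp_mart /x expRD mulrCA.
(* The growth rate at [2 * c] exceeds twice the rate at [c] by rho^2 c^2. *)
have xxE : mart (2 * c) t w =
    ((1 - Pi t w) * (x ^+ 2 * expR (- (rho ^+ 2 * c ^+ 2 * t))))%R.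
  rewrite /exp_mart mulrCA; congr (_ * _)%R.
  by rewrite /x (expr2 (expR _)) -!expRD; congr expR; rewrite /lam; field.
have x_le : (x <= e * x ^+ 2 + (4 * e)^-1)%R.
  rewrite -subr_ge0 (_ : _ - _ = (2 * e * x - 1) ^+ 2 / (4 * e))%R.
    by rewrite divr_ge0 ?sqr_ge0// mulr_ge0// ltW.
  by field; rewrite gt_eqF.
have exp_le : (expR (rho ^+ 2 * c ^+ 2 * t) <= expR (rho ^+ 2 * c ^+ 2 * T))%R.
  by rewrite ler_expR ler_wpM2l// mulr_ge0 ?sqr_ge0.
rewrite xE xxE.
apply: (@le_trans _ _ ((1 - Pi t w) * (e * x ^+ 2) + (4 * e)^-1)%R).
  apply: (@le_trans _ _ ((1 - Pi t w) * (e * x ^+ 2 + (4 * e)^-1))%R).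
    by rewrite ler_pM2l// subr_gt0.
  rewrite mulrDr lerD2l ler_piMl ?invr_ge0 ?mulr_ge0 ?(ltW e0)//.
  by rewrite lerBlDr lerDl ltW.
rewrite lerD2r.
rewrite (_ : e * _ * _ = (1 - Pi t w) * (e * x ^+ 2) *
    (expR (rho ^+ 2 * c ^+ 2 * T) * expR (- (rho ^+ 2 * c ^+ 2 * t))))%R; last by ring.
rewrite ler_peMr//.
  by rewrite mulr_ge0 ?subr_ge0 ?(ltW q1)// mulr_ge0 ?sqr_ge0 ?(ltW e0).
rewrite -expRD -[leLHS]expR0 ler_expR -mulrBr mulr_ge0 ?subr_ge0//.
by rewrite mulr_ge0 ?sqr_ge0.
Qed.

Let capped T w : R := fine (mine (tau w) T%:E).

Let cappedE T w : (0 <= T)%R -> mine (tau w) T%:E = (capped T w)%:E.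
Proof.
move=> T0; rewrite /capped fineK// ge0_fin_numE; last first.
  by rewrite le_min tau0/= lee_fin.
by rewrite gt_min ltry orbT.
Qed.

Let capped_itv T w : (0 <= T)%R -> (0 <= capped T w <= T)%R.
Proof.
move=> T0; rewrite -!lee_fin -cappedE// le_min tau0/= lee_fin T0/=.
by rewrite ge_min lexx orbT.
Qed.

(** Applied directly, Fatou's lemma gives only the opposite inequality. Applied to the nonnegative
    difference in [exp_mart_le], whose integral on grids is explicit, it gives this one up to an
    error [e * K * init (2 * c)], where [e] is arbitrary. *)
Lemma stopped_lower c T : (0 < T)%R ->
  P.-integrable setT (fun w => (mart c (capped T w) w)%:E) /\
  (init c)%:E <= \int[P]_w (mart c (capped T w) w)%:E.
Proof.
move=> T0; pose delta n := (T * harmonic n)%R.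
have d0 n : (0 < delta n)%R by rewrite mulr_gt0// harmonic_gt0.
have mdE n : (n.+1%:R * delta n)%R = T.
  by rewrite /delta/= mulrCA mulfV ?mulr1.
pose s n w := grid_stop tau (delta n) n.+1 w.
have s0 n w : (0 <= s n w)%R by exact: grid_stop_ge0.
have sT n w : (s n w <= T)%R.
  by apply: le_trans (grid_stop_le _ _ (d0 n)) _; rewrite mdE.
have scvg w : s n w @[n --> \oo] --> capped T w.
  apply: grid_stop_cvg => //.
    by rewrite -[X in _ --> X](mulr0 T); apply: cvgM; [exact: cvg_cst|exact: cvg_harmonic].
  by apply: nearW => n; rewrite mdE cappedE// ltW.
pose N e n w := mart e (s n w) w.
pose M e w := mart e (capped T w) w.
have N0 e n w : (0 <= N e n w)%R by exact: (grid_stop_mart_ge0 SB).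
have M0 e w : (0 <= M e w)%R.
  by apply: exp_mart_ge0 SB _ _ _ _; have /andP[] := capped_itv w (ltW T0).
have mN e n : measurable_fun setT (N e n).
  exact: (measurable_grid_stop_mart SB tauS).
have NE e n : \int[P]_w (N e n w)%:E = (init e)%:E.
  exact: (grid_stop_mart_integral p01 SB tauS).
have NM e w : N e n w @[n --> \oo] --> M e w.
  by apply: exp_mart_cvg => //; have /andP[] := capped_itv w (ltW T0).
have NMe e w : (N e n w)%:E @[n --> \oo] --> (M e w)%:E.
  by apply: cvg_EFin; [exact: nearW|exact: NM].
have mM e : measurable_fun setT (M e).
  by apply: measurable_fun_cvg (mN e) _ => w _; exact: NM.
have M_le e : \int[P]_w (M e w)%:E <= (init e)%:E.
  have mNe n : measurable_fun setT (fun w => (N e n w)%:E) by exact/measurable_EFinP.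
  have := fatou P measurableT mNe (fun n w _ => N0 e n w).
  under [X in _ <= limn_einf X]eq_fun do rewrite NE.
  rewrite (cvg_limn_einf_sup (cvg_cst _)).1; apply: le_trans.
  apply: le_integral_nonmeasurable => w; rewrite (cvg_limn_einf_sup (NMe e w)).1//.
  by rewrite lee_fin.
have iM e : P.-integrable setT (EFin \o M e).
  by apply: integrable_ge0 => //; apply: le_lt_trans (M_le e) (ltry _).
have iN e n : P.-integrable setT (EFin \o N e n).
  by apply: integrable_ge0 => //; rewrite NE ltry.
split; first exact: iM.
pose K := expR (rho ^+ 2 * c ^+ 2 * T).
have Mfin e : \int[P]_w (M e w)%:E \is a fin_num.
  by rewrite ge0_fin_numE ?(le_lt_trans (M_le e)) ?ltry//;
    apply: integral_ge0 => w _; rewrite lee_fin.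
apply/lee_addgt0Pr => eta eta0.
have KI : (0 < K * init (2 * c) + 1)%R.
  rewrite ltr_wpDl// mulr_ge0 ?expR_ge0// mulr_ge0 ?expR_ge0//.
  by have /andP[_ /ltW] := p01; rewrite subr_ge0.
(* Makes the error at most [eta]; the added 1 keeps the denominator visibly positive. *)
pose e := (eta / (K * init (2 * c) + 1))%R.
have e0 : (0 < e)%R by rewrite divr_gt0.
pose h n w := (e * K * N (2 * c) n w + (4 * e)^-1 - N c n w)%R.
have h0 n w : (0 <= h n w)%R.
  by rewrite subr_ge0; apply: exp_mart_le => //; rewrite s0 sT.
have mh n : measurable_fun setT (fun w => (h n w)%:E).
  apply/measurable_EFinP; apply: measurable_funB => //.
  by apply: measurable_funD => //; exact: measurable_funM.
have icst (x : R) : P.-integrable setT (EFin \o cst x) by exact: finite_measure_integrable_cst.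
have cstE (x : R) : \int[P]_w x%:E = x%:E.
  rewrite (integral_cst P measurableT x%:E) -[RHS]mule1; congr (_ * _).
  exact: probability_setT.
have iKN n : P.-integrable setT (EFin \o (fun w => e * K * N (2 * c) n w)%R).
  exact: (integrableZl measurableT _ (iN (2 * c)%R n)).
have hE n : \int[P]_w (h n w)%:E =
    (e * K * init (2 * c) + (4 * e)^-1 - init c)%:E.
  transitivity (\int[P]_w ((fun w => e * K * N (2 * c) n w + (4 * e)^-1)%R w -
    N c n w)%:E); first by [].
  rewrite integralB_EFin//; last first.
    exact: (integrableD measurableT (iKN n) (icst (4 * e)^-1%R)).
  rewrite NE integralD_EFin//; last exact: icst.
  rewrite [in RHS]EFinB [in RHS]EFinD.
  congr (_ + _ - _); last exact: cstE.
  transitivity (\int[P]_w ((e * K)%:E * (N (2 * c)%R n w)%:E)); first by [].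
  by rewrite (integralZl measurableT (iN (2 * c)%R n)) NE.
have := fatou P measurableT mh (fun n w _ => h0 n w).
under [X in _ <= limn_einf X]eq_fun do rewrite hE.
rewrite (cvg_limn_einf_sup (cvg_cst _)).1 => hfatou.
have : \int[P]_w ((4 * e)^-1 - M c w)%:E <= (e * K * init (2 * c) + (4 * e)^-1 - init c)%:E.
  apply: le_trans hfatou; apply: le_integral_nonmeasurable => w.
    rewrite limn_einf_lim; apply: lime_ge; first exact: is_cvg_einfs.
    by apply: nearW => n; apply: le_ereal_inf_tmp => _ [i _ <-]; rewrite lee_fin.
  have : (h n w)%:E @[n --> \oo] --> (e * K * M (2 * c) w + (4 * e)^-1 - M c w)%:E.
    apply: cvg_EFin; first exact: nearW.
    apply: cvgB => //; apply: cvgD; last exact: cvg_cst.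
    by apply: cvgM => //; exact: cvg_cst.
  move=> /cvg_limn_einf_sup[-> _]; rewrite lee_fin lerB// lerDr.
  by rewrite mulr_ge0// mulr_ge0 ?expR_ge0// ltW.
rewrite integralB_EFin//; last exact: icst.
rewrite cstE.
rewrite -(fineK (Mfin c)) -EFinB lee_fin => H.
rewrite -EFinD lee_fin.
have : (e * K * init (2 * c) <= eta)%R.
  rewrite /e -mulrA -mulrA ler_piMr ?(ltW eta0)// mulrC ler_pdivrMr// mul1r.
  by rewrite lerDl.
by move: H; lra.
Qed.

End stopped_limits.

(** * Upper and lower bounds for one stopping problem *)

Section optimal_value_bounds.
Context {R : realType} (S : belief_space R) (rho p r gam : R).
Hypotheses (p01 : 0 < p < 1) (SB : belief_model rho p S).
Hypotheses (r0 : 0 < r) (gam1 : 1 < gam).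
Hypothesis gamE : rho ^+ 2 * (gam * (gam - 1)) / 2 = r.
Local Notation P := (bs_prob S).
Local Notation Pi := (@bs_belief R S).
Local Notation mart := (@exp_mart R S rho).

(** Since [gam] and [1 - gam] share the rate [r], the discounted majorant along a path is a
    combination of two martingales, to which [stopped_upper] applies whatever the stopping rule. *)
Lemma optimal_value_le (a c : R) (g : R -> \bar R) : 0 <= a -> 0 <= c ->
  (forall x, 0 < x < 1 -> (g x <= ((1 - x) *
    (a * expR (gam * logit x) + c * expR ((1 - gam) * logit x)))%:E)%E) ->
  (@optimal_value R r S g <= ((1 - p) *
    (a * expR (gam * logit p) + c * expR ((1 - gam) * logit p)))%:E)%E.
Proof.
move=> a0 c0 gle; apply: ge_ereal_sup => _ [tau tauS <-].
apply: (@le_trans _ _ (a * ((1 - p) * expR (gam * logit p)) +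
    c * ((1 - p) * expR ((1 - gam) * logit p)))%:E); last first.
  by rewrite lee_fin [leRHS]mulrDr !(mulrCA (1 - p)).
apply: le_trans (stopped_upper p01 SB tauS gam (1 - gam) a0 c0).
have tau0 w : (0 <= tau w)%E := tauS.1 w.
apply: le_integral_nonmeasurable => w; rewrite /payoff; have := tau0 w;
  case: (tau w) => [t| |]//; rewrite lee_fin => t0.
  by rewrite lee_fin addr_ge0// mulr_ge0// (exp_mart_ge0 SB).
have x01 := belief_range SB w t0.
apply: (@le_trans _ _ ((expR (- (r * t)))%:E * ((1 - Pi t w) *
    (a * expR (gam * logit (Pi t w)) + c * expR ((1 - gam) * logit (Pi t w))))%:E)%E).
  by rewrite lee_pmul2l ?lte_fin ?expR_gt0//; exact: gle.
rewrite -EFinM lee_fin /exp_mart gamE.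
have -> : rho ^+ 2 * ((1 - gam) * (1 - gam - 1)) / 2 = r by rewrite -gamE; ring.
by rewrite le_eqVlt; apply/orP; left; apply/eqP; ring.
Qed.

Let info0 t (B : set R) : 0 <= t -> measurable B ->
  @information R S t (Pi 0 @^-1` B).
Proof. by move=> t0 mB; apply: sub_right_filtration t0 _ (belief_adapted SB _ mB). Qed.

(* Stopping at once; on the null event where the belief does not start at [p]
   the rule never stops, so that its payoff is measurable. *)
Lemma optimal_value_ge_now (g : R -> \bar R) (v : R) : g p = v%:E ->
  (v%:E <= @optimal_value R r S g)%E.
Proof.
move=> gp; pose D : set (bs_Omega S) := Pi 0 @^-1` [set p].
have mD : measurable D.
  by rewrite -[D]setTI; apply: (measurable_belief SB) => //; exact: measurable_set1.
pose tau w : \bar R := if w \in D then 0%:E else +oo%E.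
apply: le_ereal_sup_tmp; exists (\int[P]_w payoff r g tau w)%E.
  exists tau => //; split=> [w|t t0]; first by rewrite /tau; case: ifP.
  rewrite (_ : [set w | _] = D); first exact: info0.
  apply/seteqP; split => w /=; rewrite /tau.
    by case: ifPn => [|_]; rewrite ?inE// leye_eq.
  by move=> wD; rewrite ifT ?inE// lee_fin.
have PD : P D = 1%E.
  have /(negligibleP P (measurableC mD)) PC : P.-negligible (~` D).
    exact: belief_start p01 SB.
  by rewrite -[D]setCK probability_setC ?PC ?sube0//; exact: measurableC.
rewrite (_ : (fun w => payoff r g tau w) = (cst v%:E) \_ D).
  rewrite -integral_mkcond integral_cst// -[leLHS]mule1.
  by rewrite le_eqVlt; apply/orP; left; apply/eqP; congr (_ * _)%E.
apply/funext => w; rewrite /payoff /tau patchE; case: ifP => //.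
by rewrite inE => ->; rewrite mulr0 oppr0 expR0 mul1e gp.
Qed.

Variable b : R.

Let above w := [set t | 0 <= t /\ b <= Pi t w].

(** Infinite on paths that start at or above [b], a null event when [p < b]. The belief is then
    exactly [b] at every finite hitting time, and the payoff involves [g] only through [g b]. *)
Definition hitting (w : bs_Omega S) : \bar R :=
  if `[< Pi 0 w < b /\ above w !=set0 >] then (inf (above w))%:E else +oo%E.

Let above_lb w : has_lbound (above w).
Proof. by exists 0 => t []. Qed.

Let above_inf_ge0 w : above w !=set0 -> 0 <= inf (above w).
Proof. by move=> a0; apply: lb_le_inf => // t []. Qed.

Lemma above_attained w : above w !=set0 -> b <= Pi (inf (above w)) w.
Proof.
move=> a0; set t := inf _.
have /choice[u uP] n : exists s, above w s /\ s < t + harmonic n.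
  have [s ws st] := inf_adherent (harmonic_gt0 n) (conj a0 (above_lb w)).
  by exists s.
have ut : u n @[n --> \oo] --> t.
  apply: (@squeeze_cvgr _ _ _ _ (fun=> t) (fun n => t + harmonic n)).
  - apply: nearW => n; have [wu /ltW ->] := uP n; rewrite andbT.
    exact: ge_inf.
  - exact: cvg_cst.
  - rewrite -[X in _ --> X]addr0; apply: cvgD; first exact: cvg_cst.
    exact: cvg_harmonic.
have Piu : Pi (u n) w @[n --> \oo] --> Pi t w.
  apply: (within_continuous_seq (@belief_continuous _ _ _ _ SB w)) => //.
    exact: above_inf_ge0.
  by move=> n; have [[]] := uP n.
apply: cvgr_to_ge Piu _; apply: nearW => n.
by have [[]] := uP n.
Qed.

Lemma below_inf w t : 0 <= t -> t < inf (above w) -> Pi t w < b.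
Proof.
move=> t0; apply: contra_ltT; rewrite -leNgt => bt.
exact: ge_inf.
Qed.

(** The belief is at least [b] at the infimum and below [b] before it; starting below [b] makes the
    infimum positive, so there are earlier times to pass to the limit from. *)
Lemma hitting_belief w : Pi 0 w < b -> above w !=set0 ->
  Pi (inf (above w)) w = b.
Proof.
move=> w0 a0; apply/eqP; rewrite eq_le above_attained// andbT.
have t0 := above_inf_ge0 a0; set t := inf _ in t0 *.
have {t0} t0 : 0 < t.
  rewrite lt_neqAle t0 andbT; apply: contraTneq w0 => tE.
  by rewrite -leNgt tE; exact: above_attained.
pose u n : R := t - t * harmonic n.
have u0 n : 0 <= u n.
  by rewrite subr_ge0 ler_piMr ?(ltW t0)// invf_le1 ?ltr0n// ler1n.
have ut : u n @[n --> \oo] --> t.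
  rewrite -[X in _ --> X]subr0; apply: cvgB; first exact: cvg_cst.
  by rewrite -[X in _ --> X](mulr0 t); apply: cvgM; [exact: cvg_cst|exact: cvg_harmonic].
have Piu : Pi (u n) w @[n --> \oo] --> Pi t w.
  exact: (within_continuous_seq (@belief_continuous _ _ _ _ SB w) (ltW t0)).
apply: cvgr_to_le Piu _; apply: nearW => n; apply/ltW/below_inf => //.
by rewrite ltrBlDr ltrDl mulr_gt0// harmonic_gt0.
Qed.

(** Multiples of t / (i + 1), capped at t: a countable dense family that never looks beyond time
    [t]. *)
Let grid_point (t : R) (ij : nat * nat) : R :=
  t * ((minn ij.2 ij.1.+1)%:R / ij.1.+1%:R).

Let grid_point_itv t ij : 0 <= t -> 0 <= grid_point t ij <= t.
Proof.
move=> t0; rewrite mulr_ge0//= ler_piMr// ler_pdivrMr// mul1r ler_nat.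
exact: geq_minr.
Qed.

Let grid_point_dense t s : 0 <= s <= t ->
  exists u : nat -> nat * nat, grid_point t (u n) @[n --> \oo] --> s.
Proof.
move=> /andP[s0 st]; have [t0|t0] := leP t 0.
  have -> : s = 0 by apply/eqP; rewrite eq_le s0 (le_trans st).
  have -> : t = 0 by apply/eqP; rewrite eq_le t0 (le_trans s0).
  exists (fun=> (0, 0)%N); rewrite /grid_point/=.
  by under eq_fun do rewrite mul0r; exact: cvg_cst.
exists (fun n => (n, Num.truncn (s / t * n.+1%:R))).
apply: (@squeeze_cvgr _ _ _ _ (fun n => s - t * harmonic n) (fun=> s)); last exact: cvg_cst.
  apply: nearW => n; rewrite /grid_point/=.
  have x0 : 0 <= s / t * n.+1%:R by rewrite mulr_ge0// divr_ge0// ltW.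
  have /andP[lex xlt] := truncn_itv x0; set j := Num.truncn _ in lex xlt *.
  have jn : (j <= n.+1)%N.
    rewrite -(ler_nat R) (le_trans lex)// ler_piMl// ler_pdivrMr// mul1r.
    exact: st.
  rewrite (minn_idPl jn); apply/andP; split; last first.
    by rewrite mulrA ler_pdivrMr// -ler_pdivlMl// mulrA [_^-1 * s]mulrC.
  rewrite lerBlDr -mulrDr -[leLHS](divfK (lt0r_neq0 t0)) mulrC ler_pM2l//.
  by rewrite /= -[X in _ + X]mul1r -mulrDl ler_pdivlMr// natr1 ltW.
rewrite -[X in _ --> X]subr0; apply: cvgB; first exact: cvg_cst.
by rewrite -[X in _ --> X](mulr0 t); apply: cvgM; [exact: cvg_cst|exact: cvg_harmonic].
Qed.

Let hits t w := exists2 s, 0 <= s <= t & b <= Pi s w.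

(** A path that misses [b] on [0, t] attains a maximum below [b], hence keeps a margin 1 / (n + 1)
    at all grid points; conversely such a margin survives limits. The event is thus described by
    countably many beliefs. *)
Lemma hits_information t : 0 <= t -> @information R S t [set w | hits t w].
Proof.
move=> t0.
pose F n i j := Pi (grid_point t (i, j)) @^-1` [set x | x <= b - harmonic n].
have -> : [set w | hits t w] = ~` \bigcup_n \bigcap_i \bigcap_j F n i j.
  apply/seteqP; split => w /=.
    move=> [s /[dup] s_itv /andP[s0 st] bs] [n _ nF].
    have [u us] := grid_point_dense s_itv.
    have : Pi (grid_point t (u i)) w @[i --> \oo] --> Pi s w.
      apply: (within_continuous_seq (@belief_continuous _ _ _ _ SB w)) => //.
      by move=> i; have /andP[] := grid_point_itv (u i) t0.
    move=> /cvgr_to_le H.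
    have : Pi s w <= b - harmonic n.
      apply: H; apply: nearW => i; have := nF (u i).1 I (u i).2 I.
      by rewrite /F/= -surjective_pairing.
    by move=> /(le_trans bs); rewrite leNgt gtrBl harmonic_gt0.
  apply: contra_notP => nhits.
  have cPi : {within `[0, t], continuous (Pi ^~ w)}.
    apply: continuous_subspaceW (@belief_continuous _ _ _ _ SB w).
    by move=> s /=; rewrite !in_itv/= => /andP[->].
  have [c c_itv cmax] := EVT_max t0 cPi.
  have cb : Pi c w < b.
    by rewrite ltNge; apply/negP => bc; apply: nhits; exists c => //.
  have [n nb] := ltr_add_invr cb.
  exists n => // i _ j _; rewrite /F/= lerBrDr (le_trans _ (ltW nb))// lerD2r.
  by apply: cmax; rewrite in_itv/= grid_point_itv.
apply: right_filtrationC; apply: right_filtration_bigcup => n.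
apply: right_filtration_bigcap => i; apply: right_filtration_bigcap => j.
have /andP[s0 st] := grid_point_itv (i, j) t0.
apply: sub_right_filtration st _ (belief_adapted SB s0 _).
rewrite (_ : [set x | _] = `]-oo, (b - harmonic n)]%classic); first exact: measurable_itv.
by apply/seteqP; split => x /=; rewrite in_itv.
Qed.

Lemma hitting_stopping : is_stopping_time hitting.
Proof.
split=> [w|t t0].
  by rewrite /hitting; case: asboolP => [[_ a0]|_]; rewrite ?lee_fin ?above_inf_ge0.
rewrite (_ : [set w | _] = [set w | hits t w] `&` Pi 0 @^-1` `]-oo, b[).
  by apply: right_filtrationI; [exact: hits_information|exact: info0].
apply/seteqP; split => w /=; rewrite in_itv/= /hitting.
  case: asboolP => [[w0 a0]|_]//; rewrite lee_fin => wt; split => //.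
  by exists (inf (above w)); rewrite ?above_inf_ge0//; exact: above_attained.
move=> [[s /andP[s0 st] bs] w0].
have a0 : above w !=set0 by exists s.
by case: asboolP => [_|[]]//; rewrite lee_fin (le_trans _ st)//; exact: ge_inf.
Qed.

(** Rewritten as z (z / (1 - z))^(gam - 1), the function is a product of increasing factors. It
    bounds the martingale before the hit by its value at [b]. *)
Lemma expR_logit_incr (x y : R) : 0 < x -> x <= y -> y < 1 ->
  (1 - x) * expR (gam * logit x) <= (1 - y) * expR (gam * logit y).
Proof.
move=> x0 xy y1; have y0 := lt_le_trans x0 xy; have x1 := le_lt_trans xy y1.
have E z : 0 < z < 1 -> (1 - z) * expR (gam * logit z) = z * expR ((gam - 1) * logit z).
  move=> z01; have -> : gam * logit z = logit z + (gam - 1) * logit z by ring.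
  rewrite expRD expR_logit// mulrA; congr (_ * _).
  by rewrite mulrC divfK// subr_eq0 eq_sym lt_eqF//; have /andP[] := z01.
rewrite !E ?x0 ?y0// ler_pM ?expR_ge0 ?(ltW x0)// ler_expR ler_wpM2l ?subr_ge0 ?(ltW gam1)//.
by apply: lerB; rewrite ler_ln ?posrE ?subr_gt0// lerD2l lerN2.
Qed.

(** The martingale stopped at [hitting] or at a horizon [T] keeps at least its initial mean. If the
    hit comes by [T], [a] times it is the payoff; otherwise the belief is still below [b] and it is
    at most [C * expR (- (r * T))]. *)
Lemma optimal_value_ge_hit (a : R) (g : R -> \bar R) : 0 <= a -> p < b -> b < 1 ->
  g b = (a * ((1 - b) * expR (gam * logit b)))%:E ->
  ((a * ((1 - p) * expR (gam * logit p)))%:E <= @optimal_value R r S g)%E.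
Proof.
move=> a0 pb b1 gb; have b0 : 0 < b by apply: lt_trans pb; have /andP[] := p01.
pose C := a * ((1 - b) * expR (gam * logit b)).
have C0 : 0 <= C by rewrite mulr_ge0// mulr_ge0 ?expR_ge0// subr_ge0 ltW.
apply: le_ereal_sup_tmp; exists (\int[P]_w payoff r g hitting w)%E.
  by exists hitting => //; exact: hitting_stopping.
apply/lee_addgt0Pr => eta eta0.
(* By e^(r T) >= 1 + r T, this horizon makes the discounted [C] at most [eta]. *)
pose T : R := C / (r * eta) + 1.
have T0 : 0 < T by rewrite ltr_wpDl// divr_ge0// mulr_ge0 ?ltW.
have CT : C * expR (- (r * T)) <= eta.
  have rT : 0 < 1 + r * T by rewrite addr_gt0// mulr_gt0.
  rewrite expRN ler_pdivrMr ?expR_gt0//.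
  apply: (@le_trans _ _ (eta * (1 + r * T))); last by rewrite ler_pM2l// expR_ge1Dx.
  rewrite /T mulrDr mulr1 (_ : eta * (r * _) = C + eta * r); last first.
    by rewrite /T; field; rewrite !gt_eqF.
  by rewrite addrCA lerDl addr_ge0 ?mulr_ge0 ?ltW.
pose s w : R := fine (mine (hitting w) T%:E).
have [iM initM] := stopped_lower p01 SB hitting_stopping gam T0.
pose M w := mart gam (s w) w.
have mM : measurable_fun setT M.
  by apply/measurable_EFinP; exact: (measurable_int P iM).
have s_itv w : 0 <= s w <= T.
  rewrite /s; have := hitting_stopping.1 w; case: (hitting w) => [t| |]//.
    rewrite -EFin_min lee_fin => t0.
    by rewrite le_min ge_min lexx orbT (ltW T0) t0.
  by rewrite min_r ?leey//= lexx ltW.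
have M0 w : 0 <= M w by apply: (exp_mart_ge0 SB); have /andP[] := s_itv w.
pose D : set (bs_Omega S) := Pi 0 @^-1` `]-oo, b[.
have mD : measurable D.
  by rewrite -[D]setTI; apply: (measurable_belief SB) => //; exact: measurable_itv.
pose f w := (a * M w - C * expR (- (r * T)))%:E.
have mf : measurable_fun setT f.
  by apply/measurable_EFinP; apply: measurable_funB => //; exact: measurable_funM.
(* Cutting down to [D] loses only a null event, as the belief starts at [p < b]; off [D] the hitting
   time is infinite and the payoff is 0, so the comparison holds on every path. *)
have int_f : (\int[P]_w (f \_ D) w = \int[P]_w f w)%E.
  apply: ae_eq_integral => //.
    by apply/(measurable_restrictT _ mD); exact: measurable_funTS.
  apply: filterS (belief_start p01 SB) => w w0 _.
  by rewrite patchE ifT// inE /D/= in_itv/= w0.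
have f_le w : ((f \_ D) w <= payoff r g hitting w)%E.
  rewrite patchE /payoff; case: ifPn => [|wD]; last first.
    rewrite (_ : hitting w = +oo%E)// /hitting; case: asboolP => // -[w0 _].
    by move: wD; rewrite notin_setE /D/= in_itv/=.
  rewrite inE /D/= in_itv/= => w0.
  have late : Pi T w < b -> s w = T -> (f w <= 0%:E)%E.
    move=> Tb sT; rewrite lee_fin subr_le0 /M sT /exp_mart gamE (mulrCA a).
    rewrite [leRHS]mulrC ler_pM2l ?expR_gt0// ler_wpM2l//.
    apply: expR_logit_incr => //; last exact: ltW.
    by have /andP[] := belief_range SB w (ltW T0).
  have hitE t : hitting w = t%:E -> [/\ 0 <= t, Pi t w = b &
      forall u, 0 <= u -> u < t -> Pi u w < b].
    rewrite /hitting; case: asboolP => [[_ aw]|_]// [<-]; split.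
    - exact: above_inf_ge0.
    - exact: hitting_belief.
    - by move=> u u0; exact: below_inf.
  case hw : (hitting w) => [t| |].
  - have [t0 tb tlt] := hitE _ hw.
    have pay0 : 0 <= expR (- (r * t)) * C by rewrite mulr_ge0 ?expR_ge0.
    rewrite tb gb -EFinM -/C.
    have [tT|Tt] := leP t T; last first.
      apply: le_trans (late _ _) _; rewrite ?lee_fin//.
        by apply: tlt => //; exact: ltW.
      by rewrite /s hw min_r// lee_fin ltW.
    rewrite lee_fin /M /s hw min_l ?lee_fin//= /exp_mart gamE tb.
    by rewrite mulrCA gerBl mulr_ge0// expR_ge0.
  - apply: late; last by rewrite /s hw min_r ?leey.
    rewrite ltNge; apply/negP => bT; move: hw; rewrite /hitting.
    case: asboolP => // H _; apply: H; split => //.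
    by exists T; split => //; exact: ltW.
  - by have := hitting_stopping.1 w; rewrite hw.
have pay0 w : (0 <= payoff r g hitting w)%E.
  rewrite /payoff; case hw : (hitting w) => [t| |]//.
  move: hw; rewrite /hitting; case: asboolP => [[w0 aw]|_]// [<-].
  by rewrite hitting_belief// gb -EFinM lee_fin mulr_ge0 ?expR_ge0.
have iaM : P.-integrable setT (EFin \o (fun w => a * M w)).
  exact: (integrableZl measurableT a iM).
have ic (x : R) : P.-integrable setT (EFin \o cst x).
  exact: finite_measure_integrable_cst.
have fE : (\int[P]_w f w =
    a%:E * \int[P]_w (M w)%:E - (C * expR (- (r * T)))%:E)%E.
  have := integralB_EFin measurableT iaM (ic (C * expR (- (r * T)))).
  rewrite -[LHS]/(\int[P]_w f w)%E => ->; congr (_ - _)%E.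
    by rewrite -(integralZl measurableT iM).
  rewrite (integral_cst P measurableT (C * expR (- (r * T)))%:E) -[RHS]mule1.
  by congr (_ * _)%E; exact: probability_setT.
have le_pay := le_integral_nonmeasurable P pay0 f_le.
have : (a%:E * \int[P]_w (M w)%:E <= \int[P]_w payoff r g hitting w + eta%:E)%E.
  rewrite -leeBlDr//; apply: le_trans le_pay; rewrite int_f fE.
  by rewrite leeB// lee_fin.
by apply: le_trans; rewrite EFinM lee_wpmul2l ?lee_fin.
Qed.

End optimal_value_bounds.

(** * One step of the recursion *)

Lemma ltr_logit {R : realType} (x y : R) : 0 < x < 1 -> 0 < y < 1 ->
  (logit x < logit y) = (x < y).
Proof.
have mono (z t : R) : 0 < z < 1 -> 0 < t < 1 -> z < t -> logit z < logit t.
  move=> /andP[z0 z1] /andP[t0 t1] zt.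
  by apply: ltrB; rewrite ltr_ln ?posrE ?subr_gt0// ltrD2l ltrN2.
move=> x01 y01; case: (ltgtP x y) => [xy|yx|->]; last exact: ltxx.
  exact: mono.
by apply/negbTE; rewrite -leNgt ltW// mono.
Qed.

Lemma powR_odds {R : realType} (x c : R) : 0 < x < 1 ->
  (x / (1 - x)) `^ c = expR (c * logit x).
Proof. by move=> x01; rewrite -expR_logit// /powR gt_eqF ?expR_gt0// expRK. Qed.

Section value_recursion.
Context {R : realType}.
Variables (N : nat) (r k : R) (rho : R -> R) (S : R -> R -> belief_space R).
Hypotheses (r0 : 0 < r) (k01 : 0 < k < 1).
Hypothesis rho_pos : forall u, 0 <= u <= 1 -> 0 < rho u.
Hypothesis SB : forall u p, 0 <= u <= 1 -> 0 < p < 1 ->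
  belief_model (rho u) p (S u p).
Local Notation V := (value r k N S).
Local Notation gam := (gamma_ r N rho).

Lemma grid_itv m : (0 < N)%N -> (m <= N)%N -> 0 <= (grid N m : R) <= 1.
Proof.
move=> N0 mN; rewrite /grid divr_ge0//= ler_pdivrMr ?ltr0n//.
by rewrite mul1r ler_nat.
Qed.

Lemma gamma_gt1 u : 0 < rho u -> 1 < gamma r rho u.
Proof.
move=> rho0; have d0 : 0 < 2 * r / rho u ^+ 2 by rewrite divr_gt0 ?mulr_gt0 ?exprn_gt0.
have -> : 1 = 2^-1 + 2^-1 :> R by field.
rewrite /gamma ltrD2l -[ltLHS]ger0_norm ?invr_ge0// -sqrtr_sqr ltr_sqrt; last first.
  by rewrite addr_gt0// invr_gt0.
by rewrite (_ : 2^-1 ^+ 2 = 4^-1) ?ltrDl//; field.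
Qed.

Lemma gammaE u : 0 < rho u ->
  rho u ^+ 2 * (gamma r rho u * (gamma r rho u - 1)) / 2 = r.
Proof.
move=> rho0; have d0 : 0 <= 4^-1 + 2 * r / rho u ^+ 2.
  by rewrite addr_ge0 ?invr_ge0// divr_ge0 ?mulr_ge0 ?exprn_ge0 ?ltW.
have := sqr_sqrtr d0; rewrite /gamma; set q := Num.sqrt _ => qE.
have -> : (2^-1 + q) * (2^-1 + q - 1) = q ^+ 2 - 4^-1 by field.
by rewrite qE; field; rewrite gt_eqF.
Qed.

Lemma gamma_decr u u' : 0 < rho u -> rho u <= rho u' ->
  gamma r rho u' <= gamma r rho u.
Proof.
move=> rho0 rhole; have rho0' := lt_le_trans rho0 rhole.
rewrite lerD2l ler_wsqrtr// lerD2l ler_pM2l ?mulr_gt0//.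
by rewrite lef_pV2 ?posrE ?exprn_gt0// ler_pXn2r ?nnegrE ?(ltW rho0) ?(ltW rho0').
Qed.

(** Upper bound: the tangent majorant touching [v] at [logit p]. Lower bound: the hitting time of
    [b] when [p < b], immediate stopping otherwise. Each prior has its own belief space, so both
    bounds are taken for a fixed [p], and different priors meet only through [v]. *)
Lemma value_step m b gam' b' v' dv' : (0 < N)%N -> (m <= N)%N -> 0 < b < 1 ->
  gam' <= gam m -> logit b <= b' -> value_shape gam' b' v' dv' ->
  (forall p, 0 < p < 1 -> V m.+1 p = ((1 - p) * v' (logit p))%:E) ->
  (gam m + k - 1) * b - gam m * k + (gam m - gam') * ((1 - b) * v' (logit b)) = 0 ->
  exists v dv a, [/\ value_shape (gam m) (logit b) v dv,
    forall p, 0 < p < 1 -> V m p = ((1 - p) * v (logit p))%:E,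
    a * G_ r N rho m b = b - k + (1 - b) * v' (logit b),
    forall p, 0 < p < b -> V m p = (a * G_ r N rho m p)%:E &
    forall p, b <= p < 1 -> V m p = ((p - k)%:E + V m.+1 p)%E].
Proof.
move=> N0 mN b01 gamle bb' vS V'E fb0.
have u01 := grid_itv N0 mN; have rho0 := rho_pos u01.
have gam1 : 1 < gam m by exact: gamma_gt1.
have gE := gammaE rho0; rewrite -/(gam m) in gE.
have expE x : 0 < x < 1 -> (1 - x) * expR (logit x) = x.
  move=> x01; rewrite expR_logit// mulrC divfK// gt_eqF// subr_gt0.
  by have /andP[] := x01.
have [b0 b1] := andP b01; have q0 : 0 < 1 - b by rewrite subr_gt0.
have Fb : (gam m - 1) * ((1 - k) * expR (logit b)) - gam m * k +
    (gam m - gam') * v' (logit b) = 0.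
  apply: (mulfI (lt0r_neq0 q0)); rewrite mulr0 -[RHS]fb0.
  transitivity ((gam m - 1) * (1 - k) * ((1 - b) * expR (logit b)) -
    (1 - b) * (gam m * k) + (gam m - gam') * ((1 - b) * v' (logit b))); first by ring.
  by rewrite expE//; ring.
have [v [dv [a [a0 [vshape vge ab vlt vgt]]]]] := shape_step k01 gam1 gamle bb' vS Fb.
have gainE x : 0 < x < 1 ->
    (V m.+1 x + (x - k)%:E = ((1 - x) * ((1 - k) * expR (logit x) - k + v' (logit x)))%:E)%E.
  move=> x01; rewrite V'E// -EFinD; congr EFin.
  rewrite (_ : _ * (_ + _) = (1 - k) * ((1 - x) * expR (logit x)) - (1 - x) * k +
    (1 - x) * v' (logit x)); last by ring.
  by rewrite expE//; ring.
have GE x : 0 < x < 1 -> a * G_ r N rho m x = a * ((1 - x) * expR (gam m * logit x)).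
  by move=> x01; rewrite /G_ powR_odds.
have VE p : 0 < p < 1 -> V m p = ((1 - p) * v (logit p))%:E.
  move=> p01; have [p0 p1] := andP p01; rewrite value_rec//.
  have PB := SB u01 p01.
  apply/eqP; rewrite eq_le; apply/andP; split.
    have [A [C [A0 C0 vp vmaj]]] := shape_majorant (logit p) gam1 vshape.
    rewrite vp; apply: (optimal_value_le p01 PB gE A0 C0) => x x01.
    rewrite gainE// lee_fin ler_pM2l ?subr_gt0; last by have /andP[] := x01.
    exact: le_trans (vge _) (vmaj _).
  have [pb|bp] := ltP p b.
    have -> : (1 - p) * v (logit p) = a * ((1 - p) * expR (gam m * logit p)).
      by rewrite vlt ?ltr_logit//; ring.
    apply: (optimal_value_ge_hit p01 PB r0 gam1 gE (b := b)) => //.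
    by rewrite gainE// -ab; congr EFin; ring.
  apply: (optimal_value_ge_now r p01 PB).
  by rewrite gainE// vgt// leNgt ltr_logit// -leNgt.
exists v, dv, a; split => //.
  rewrite GE// (mulrCA a) ab.
  by have := gainE _ b01; rewrite V'E// -EFinD => -[<-]; rewrite addrC.
  move=> p /andP[p0 pb]; have p01 : 0 < p < 1 by rewrite p0 (lt_trans pb).
  by rewrite VE// GE// vlt ?ltr_logit//; congr EFin; ring.
move=> p /andP[bp p1]; have p01 : 0 < p < 1 by rewrite p1 (lt_le_trans b0).
by rewrite addeC gainE// VE// vgt// leNgt ltr_logit// -leNgt.
Qed.

End value_recursion.

Theorem proposition7p4 (R : realType) (N : nat) (r k : R) (rho : R -> R)
  (S : R -> R -> belief_space R) (n : nat) (b A : nat -> R)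
  (hN : (1 <= N)%N) (hr : 0 < r) (hk : 0 < k < 1)
  (hrho_pos : forall u, 0 <= u <= 1 -> 0 < rho u)
  (hrho_mono : forall u v, 0 <= u -> u <= v -> v <= 1 -> rho u <= rho v)
  (hrho_bounded : exists M, forall u, 0 <= u <= 1 -> rho u <= M)
  (hrho_strict : forall m, (m < N)%N -> rho (grid N m) < rho (grid N m.+1))
  (hS : forall u p, 0 <= u <= 1 -> 0 < p < 1 -> belief_model (rho u) p (S u p))
  (hn : (n < N)%N)
  (hb_range : forall m, (n < m <= N)%N -> 0 < b m < 1)
  (hb_mono : forall m, (n < m)%N -> (m < N)%N -> b m <= b m.+1)
  (hV : forall m, (n < m <= N)%N -> forall p, 0 < p < 1 ->
     value r k N S m p
     = threshold_fun r k N rho (value r k N S) m (A m) (b m) p)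
  (hf : forall m, (n < m <= N)%N -> f_ r k N rho (value r k N S) m (b m) = 0%E)
  (hbn_range : 0 < b n < c_ r k N rho n)
  (hbn : f_ r k N rho (value r k N S) n (b n) = 0%E)
  (hAn : (A n * G_ r N rho n (b n))%:E
         = ((b n - k)%:E + value r k N S n.+1 (b n))%E)
  (hbn_le : b n <= b n.+1) :
  forall p, 0 < p < 1 ->
    threshold_fun r k N rho (value r k N S) n (A n) (b n) p = value r k N S n p.
Proof.
have k01 := hk; have [k0 k1] := andP hk.
have N0 : (0 < N)%N by [].
pose V := value r k N S; pose gam := gamma_ r N rho.
have rho_grid m : (m <= N)%N -> 0 < rho (grid N m).
  by move=> mN; apply: hrho_pos; exact: grid_itv.
have gam1 m : (m <= N)%N -> 1 < gam m by move=> mN; exact/gamma_gt1/rho_grid.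
have b01 m : (n <= m <= N)%N -> 0 < b m < 1.
  move=> /andP[]; rewrite leq_eqVlt => /predU1P[<- nN|nm mN]; last first.
    by apply: hb_range; rewrite nm.
  have [b0 bc] := andP hbn_range; rewrite b0/= (lt_trans bc)//.
  have := gam1 _ nN; rewrite /c_ -/(gam n) => g1.
  (* c_n < 1, since gam + k - 1 - gam k = (gam - 1) (1 - k) > 0. *)
  by rewrite ltr_pdivrMr ?mul1r; nra.
have b_mono m : (n <= m < N)%N -> b m <= b m.+1.
  move=> /andP[]; rewrite leq_eqVlt => /predU1P[<- //|]; exact: hb_mono.
have fb m : (n <= m <= N)%N -> f_ r k N rho V m (b m) = 0%E.
  move=> /andP[]; rewrite leq_eqVlt => /predU1P[<- //|nm mN].
  by apply: hf; rewrite nm.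
have stage m : (n <= m <= N)%N -> exists v dv a, [/\
    value_shape (gam m) (logit (b m)) v dv,
    forall p, 0 < p < 1 -> V m p = ((1 - p) * v (logit p))%:E,
    ((a * G_ r N rho m (b m))%:E = (b m - k)%:E + V m.+1 (b m))%E,
    forall p, 0 < p < b m -> V m p = (a * G_ r N rho m p)%:E &
    forall p, b m <= p < 1 -> V m p = ((p - k)%:E + V m.+1 p)%E].
  move=> /andP[nm mN]; rewrite -(subKn mN).
  have : (N - m <= N - n)%N by rewrite leq_sub2l.
  elim: (N - m)%N => [_|j IH jn].
    rewrite subn0; have nN : (n <= N <= N)%N by rewrite ltnW/=.
    have bN := b01 _ nN.
    have VE p : 0 < p < 1 -> V N.+1 p = ((1 - p) * 0)%:E.
      by rewrite /V value_end mulr0.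
    (* The value after the last one is 0 and fits any exponent; [gam N] is taken because [gam N.+1]
       would involve [rho] outside [0, 1]. *)
    have fN : (gam N + k - 1) * b N - gam N * k + (gam N - gam N) * ((1 - b N) * 0) = 0.
      have := fb _ nN; rewrite /f_ /V value_end mule0 adde0 => -[].
      by rewrite subrr mul0r addr0.
    have [v [dv [a [? ? aE ? ?]]]] := value_step hr k01 hrho_pos hS N0 (leqnn N) bN
      (lexx _) (lexx _) (value_shape0 (gam N) (logit (b N))) VE fN.
    by exists v, dv, a; split => //; rewrite aE VE.
  pose l := (N - j.+1)%N.
  have lN : (l < N)%N by rewrite /l ltn_subrL.
  have lE : (N - j)%N = l.+1 by rewrite /l subnSK// (leq_trans jn)// leq_subr.
  have nl : (n <= l)%N by rewrite /l leq_subRL ?(leq_trans jn) ?leq_subr//;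
    rewrite addnC -leq_subRL// ltnW.
  have [|v' [dv' [a' [vS VE _ _ _]]]] := IH.
    exact: ltnW.
  rewrite lE in vS VE.
  have bl01 : 0 < b l < 1 by apply: b01; rewrite nl ltnW.
  have bl01' : 0 < b l.+1 < 1 by apply: b01; rewrite lN (leq_trans nl).
  have gamle : gam l.+1 <= gam l.
    exact: gamma_decr (rho_grid _ (ltnW lN)) (ltW (hrho_strict _ lN)).
  have bb : logit (b l) <= logit (b l.+1).
    by rewrite leNgt ltr_logit// -leNgt b_mono// nl.
  have fl : (gam l + k - 1) * b l - gam l * k +
      (gam l - gam l.+1) * ((1 - b l) * v' (logit (b l))) = 0.
    have := fb l; rewrite nl (ltnW lN) => /(_ isT).
    by rewrite /f_ VE// -EFinM -EFinD => -[].
  have [v [dv [a [? ? aE ? ?]]]] := value_step hr k01 hrho_pos hS N0 (ltnW lN) bl01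
    gamle bb vS VE fl.
  by exists v, dv, a; split => //; rewrite aE VE.
have [|v [dv [a [_ _ aE below above]]]] := stage n; first by rewrite leqnn ltnW.
have bn : 0 < b n < 1 by apply: b01; rewrite leqnn ltnW.
(* Both constants satisfy continuous fit at b_n, where G_n is positive. *)
have Aa : A n = a.
  move: hAn; rewrite -aE => -[]; apply: mulIf.
  by rewrite gt_eqF// /G_ powR_odds// mulr_gt0 ?expR_gt0// subr_gt0; have /andP[] := bn.
move=> p /andP[p0 p1]; rewrite /threshold_fun; case: ltP => pb.
  by rewrite Aa; apply/esym/below; rewrite p0.
by apply/esym/above; rewrite pb.
Qed.
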